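(* Let $m>1$. If a transition point $\beta_c>0$ of $\mathcal F_\beta^m$ is continuous, then $\beta_c=\beta_\sharp^m$, where $$\beta_\sharp^m:=-\frac{m\,\rho_\infty^{m-3/2}}{\displaystyle\min_{k\in\mathbb N^d,\,k\ne0}\frac{\hat W(k)}{\Theta(k)}}.$$
   Context: $\Omega=\mathbb T^d$ is the torus of side length $L>0$, $\rho_\infty:=L^{-d}=|\Omega|^{-1}$; $\mathcal P(\Omega)$ is the set of Borel probability measures on $\Omega$, identified with their densities when these exist. $W\in C^2(\Omega)$ is even along every coordinate and has mean zero. For $m>1$, $$\mathcal F_\beta^m(\rho)=\frac{\beta^{-1}}{m-1}\int_\Omega\rho^m\,dx-\frac{\beta^{-1}}{m-1}+\frac12\iint_{\Omega\times\Omega}W(x-y)\rho(x)\rho(y)\,dx\,dy$$ whenever these quantities are finite, and $+\infty$ otherwise; ''minimiser'' means minimiser over $\mathcal P(\Omega)$. Fourier conventions ($\mathbb N\ni0$): for $k\in\mathbb Z^d$, $e_k(x)=N_k\prod_{i=1}^d e_{k_i}(x_i)$ with $e_{k_i}(x_i)=\cos(2\pi k_ix_i/L)$ if $k_i>0$, $1$ if $k_i=0$, $\sin(2\pi k_ix_i/L)$ if $k_i<0$; $N_k=L^{-d/2}\Theta(k)$, $\Theta(k)=\prod_{i=1}^d(2-\delta_{k_i,0})^{1/2}$; $\hat W(k)=\langle W,e_k\rangle_{L^2(\Omega)}$. Transition point: $\beta_c>0$ is a transition point of $\mathcal F_\beta^m$ if (1) for $\beta<\beta_c$, $\rho_\infty$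 is the unique minimiser of $\mathcal F_\beta^m$; (2) at $\beta=\beta_c$, $\rho_\infty$ is a minimiser; (3) for every $\beta>\beta_c$ there exists a minimiser $\rho_\beta\neq\rho_\infty$ of $\mathcal F_\beta^m$. (A transition point exists only if $\hat W(k)<0$ for some $k\in\mathbb N^d\setminus\{0\}$, so the minimum defining $\beta_\sharp^m$ is then negative.) A transition point $\beta_c$ is continuous if (1) at $\beta=\beta_c$, $\rho_\infty$ is the unique minimiser of $\mathcal F_{\beta_c}^m$, and (2) for any family $\{\rho_\beta\}_{\beta>\beta_c}$ with $\rho_\beta$ a minimiser of $\mathcal F_\beta^m$, $\limsup_{\beta\to\beta_c^+}\|\rho_\beta-\rho_\infty\|_{L^\infty(\Omega)}=0$. *)

(* Defs.v *)
From HB Require Import structures.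
From mathcomp Require Import all_boot all_order all_algebra.
From mathcomp Require Import all_classical all_reals all_analysis.

Set Implicit Arguments.
Unset Strict Implicit.
Unset Printing Implicit Defensive.

Import Order.TTheory GRing.Theory Num.Theory.
Import numFieldNormedType.Exports.

Local Open Scope classical_set_scope.
Local Open Scope ring_scope.

(* The torus of side length L is represented by its fundamental domain
   [0, L)^d inside R^d.  For measure theory R^d is the type [space R d] of
   d-tuples, whose sigma-algebra is the product (i.e. Borel) one; for topology
   and derivatives it is ['rV[R]_d].  Functions on the torus are L-periodic
   functions on R^d; Borel probability measures on the torus are Borel
   probability measures on R^d giving mass 1 to [0, L)^d. *)

Notation space R d := (d.-tuple (measurableTypeR R)).

Section circle_measure.
Context (R : realType) (L : {posnum R}).

Definition circle_dom : set (measurableTypeR R) := `[0, L%:num[.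

Lemma measurable_circle_dom : measurable circle_dom.
Proof. exact: measurable_itv. Qed.

Lemma lebesgue_circle_dom : lebesgue_measure circle_dom = L%:num%:E.
Proof. by rewrite /circle_dom lebesgue_measure_itv/= lte_fin gt0// oppr0 adde0. Qed.

Lemma lebesgue_circle_dom_lty : (lebesgue_measure circle_dom < +oo)%E.
Proof. by rewrite lebesgue_circle_dom ltry. Qed.

Definition circle_measure : set (measurableTypeR R) -> \bar R :=
  mfrestr measurable_circle_dom lebesgue_circle_dom_lty.

HB.instance Definition _ := FiniteMeasure.on circle_measure.

Lemma circle_measureT : circle_measure setT = L%:num%:E.
Proof.
by rewrite /circle_measure /mfrestr /mrestr setTI lebesgue_circle_dom.
Qed.

End circle_measure.

Section cons_measure.
Context (R : realType) (n : nat).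
Variables (m1 : {finite_measure set (measurableTypeR R) -> \bar R})
          (m2 : {finite_measure set (space R n) -> \bar R}).

Definition tuple_cons (p : measurableTypeR R * space R n) : space R n.+1 :=
  [tuple of p.1 :: p.2].

Lemma measurable_tuple_cons : measurable_fun setT tuple_cons.
Proof. exact: measurable_cons. Qed.

HB.instance Definition _ :=
  isMeasurableFun.Build _ _ _ _ tuple_cons measurable_tuple_cons.

Definition cons_measure : set (space R n.+1) -> \bar R :=
  pushforward (m1 \x m2)%E tuple_cons.

Let cons_measure0 : cons_measure set0 = 0%E.
Proof. exact: measure0. Qed.

Let cons_measure_ge0 A : (0 <= cons_measure A)%E.
Proof. exact: measure_ge0. Qed.

Let cons_measure_sigma_additive : semi_sigma_additive cons_measure.
Proof. exact: measure_semi_sigma_additive. Qed.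

HB.instance Definition _ := isMeasure.Build _ _ _ cons_measure
  cons_measure0 cons_measure_ge0 cons_measure_sigma_additive.

Lemma cons_measureT : cons_measure setT = (m1 setT * m2 setT)%E.
Proof.
by rewrite /cons_measure /pushforward preimage_setT -setXTT product_measure1E.
Qed.

Let cons_measure_fin : fin_num_fun cons_measure.
Proof.
move=> A mA; rewrite ge0_fin_numE//.
apply: (@le_lt_trans _ _ (cons_measure setT)).
  by apply: le_measure; rewrite ?inE.
by rewrite cons_measureT lte_mul_pinfty// ?ge0_fin_numE// ?ltey_eq
  fin_num_measure.
Qed.

HB.instance Definition _ := Measure_isFinite.Build _ _ _ cons_measure
  cons_measure_fin.

End cons_measure.

Section torus.
Context (R : realType) (L : {posnum R}).

(* Lebesgue measure of R^d restricted to [0, L)^d, as a d-fold product. *)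
Fixpoint torus_measure (d : nat) : {finite_measure set (space R d) -> \bar R} :=
  match d with
  | 0 => dirac ([tuple] : space R 0)
  | n.+1 => cons_measure (circle_measure L) (torus_measure n)
  end.

Definition torus_dom (d : nat) : set (space R d) :=
  [set x | forall i, 0 <= tnth x i < L%:num].

Lemma torus_measureT d : torus_measure d setT = (L%:num ^+ d)%:E.
Proof.
elim: d => [|d IHd]; first by rewrite /= diracT expr0.
by rewrite /= cons_measureT IHd/= circle_measureT -EFinM exprS.
Qed.

Lemma torus_measure_box d (A : 'I_d -> set (measurableTypeR R)) :
  (forall i, measurable (A i)) ->
  torus_measure d [set x | forall i, A i (tnth x i)] =
  (\prod_(i < d) circle_measure L (A i))%E.
Proof.
elim: d A => [|d IHd] A mA.
  rewrite big_ord0 (_ : [set x | _] = setT) ?torus_measureT ?expr0//.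
  by apply/seteqP; split => // x _ [].
have mB : measurable [set x : space R d | forall i, A (lift ord0 i) (tnth x i)].
  rewrite (_ : [set x | _] =
      \bigcap_(i in [set: 'I_d]) (@tnth _ _ ^~ i @^-1` A (lift ord0 i))).
    apply: fin_bigcap_measurable => // i _.
    by rewrite -[X in measurable X]setTI; exact: measurable_tnth.
  by apply/seteqP; split => x; [move=> h i _|move=> h i]; apply: h.
rewrite big_ord_recl -(IHd (fun i => A (lift ord0 i))) //.
rewrite -product_measure1E//= /cons_measure /pushforward.
congr (_ _); apply/seteqP; split => -[x y] /=.
  move=> h; split; first by have := h ord0.
  by move=> i; have := h (lift ord0 i); rewrite tnthS.
move=> [h0 h] i; case: (unliftP ord0 i) => [j|] ->; last exact: h0.
by rewrite tnthS; exact: h.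
Qed.

Definition rho_inf (d : nat) : R := (L%:num ^+ d)^-1.

End torus.
Arguments torus_dom {R} L d _.

Section uniform_state.
Context (R : realType) (L : {posnum R}) (d : nat).

Lemma rho_inf_ge0 : 0 <= rho_inf L d.
Proof. by rewrite /rho_inf. Qed.

Definition uniform_state : set (space R d) -> \bar R :=
  mscale (NngNum rho_inf_ge0) (torus_measure L d).

HB.instance Definition _ := Measure.on uniform_state.

Let uniform_stateT : uniform_state setT = 1%E.
Proof.
by rewrite /uniform_state /mscale/= torus_measureT -EFinM mulVf// gt_eqF.
Qed.

HB.instance Definition _ := Measure_isProbability.Build _ _ _ uniform_state
  uniform_stateT.

End uniform_state.
Arguments uniform_state {R} L d _.

Section potential.
Context (R : realType) (L : {posnum R}) (d : nat).
Implicit Type W : 'rV[R]_d -> R.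

Definition vec (x : space R d) : 'rV[R]_d := \row_i tnth x i.

(* Membership in C^n: all iterated partial derivatives of order at most n
   exist and are continuous. *)
Fixpoint class_C (n : nat) (f : 'rV[R]_d -> R) : Prop :=
  continuous f /\
  match n with
  | 0 => True
  | n'.+1 => forall i : 'I_d,
      (forall x, derivable f x (delta_mx 0 i)) /\
      class_C n' (fun x => 'D_(delta_mx 0 i) f x)
  end.

Definition torus_periodic W : Prop :=
  forall (i : 'I_d) (x : 'rV[R]_d), W (x + L%:num *: delta_mx 0 i) = W x.

Definition even_coordinates W : Prop :=
  forall (i : 'I_d) (x : 'rV[R]_d),
    W (\row_j (if j == i then - x 0 j else x 0 j)) = W x.

Definition mean_zero W : Prop :=
  (\int[torus_measure L d]_x W (vec x) = 0)%R.

End potential.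

Section fourier.
Context (R : realType) (L : {posnum R}) (d : nat).
Implicit Types (k : 'I_d -> int) (W : 'rV[R]_d -> R).

(* The factor of a negative frequency k is sin (2 pi k t / L), with the sign of
   k kept inside the sine. *)
Definition mode1 (k : int) (t : R) : R :=
  if 0 < k then cos (2 * pi * k%:~R * t / L%:num)
  else if k == 0 then 1
  else sin (2 * pi * k%:~R * t / L%:num).

Definition Theta k : R := \prod_i Num.sqrt (2 - (k i == 0)%:R).

Definition fourier_norm k : R := L%:num `^ (- (d%:R / 2)) * Theta k.

Definition mode k (x : 'rV[R]_d) : R :=
  fourier_norm k * \prod_i mode1 (k i) (x 0 i).

Definition fourier_coef W k : R :=
  (\int[torus_measure L d]_x (W (vec x) * mode k (vec x)))%R.

Definition mode_ratios W : set R :=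
  [set r | exists k : 'I_d -> nat, (exists i, k i != 0%N) /\
     r = fourier_coef W (fun i => (k i)%:Z) / Theta (fun i => (k i)%:Z)].

Definition is_min (A : set R) (a : R) : Prop := A a /\ lbound A a.

(* [is_beta_sharp m W b] also asserts that the minimum in the definition of
   the threshold is attained, so that it is a minimum and not just an
   infimum. *)
Definition is_beta_sharp (m : R) W (b : R) : Prop :=
  exists2 w, is_min (mode_ratios W) w &
    b = - (m * rho_inf L d `^ (m - 3 / 2) / w).

End fourier.

Section free_energy.
Local Open Scope charge_scope.
Context (R : realType) (L : {posnum R}) (d : nat).
Variables (m : R) (W : 'rV[R]_d -> R).
Implicit Types (beta : R) (P Q : probability (space R d) R).

Let mu := torus_measure L d.

(* The density of P; only meaningful when [P `<< mu], in which case the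
   Radon-Nikodym derivative is finite everywhere. *)
Definition density P (x : space R d) : R :=
  fine ('d (charge_of_finite_measure P) '/d mu x).

Definition power_integral P : \bar R :=
  (\int[mu]_x (density P x `^ m)%:E)%E.

Definition interaction P : \bar R :=
  (\int[mu \x mu]_z
    (W (vec z.1 - vec z.2) * density P z.1 * density P z.2)%:E)%E.

Definition free_energy beta P : \bar R :=
  if `[< [/\ P `<< mu, power_integral P \is a fin_num
           & interaction P \is a fin_num] >]
  then ((beta^-1 / (m - 1))%:E * power_integral P - (beta^-1 / (m - 1))%:E
        + (2^-1)%:E * interaction P)%E
  else +oo%E.

Definition on_torus P : Prop := P (torus_dom L d) = 1%E.

(* Measures are functions on all sets but are only determined on the
   measurable ones, hence this equality of states. *)
Definition same_state P Q : Prop := forall A, measurable A -> P A = Q A.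

Definition minimiser beta P : Prop :=
  on_torus P /\
  forall Q, on_torus Q -> (free_energy beta P <= free_energy beta Q)%E.

Definition unique_minimiser beta P : Prop :=
  minimiser beta P /\ forall Q, minimiser beta Q -> same_state Q P.

(* The inverse temperature beta ranges over the positive reals. *)
Definition transition_point (beta_c : R) : Prop :=
  [/\ 0 < beta_c,
      forall beta, 0 < beta < beta_c ->
        unique_minimiser beta (uniform_state L d),
      minimiser beta_c (uniform_state L d)
    & forall beta, beta_c < beta ->
        exists2 P, minimiser beta P & ~ same_state P (uniform_state L d)].

Definition continuous_transition_point (beta_c : R) : Prop :=
  [/\ transition_point beta_c,
      unique_minimiser beta_c (uniform_state L d)
    & forall rho : R -> probability (space R d) R,
        (forall beta, beta_c < beta -> minimiser beta (rho beta)) ->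
        limf_esup (fun beta =>
            'N[mu]_+oo[(fun x => (density (rho beta) x - rho_inf L d)%:E)])%E
          beta_c^'+ = 0%E].

End free_energy.

(* Main.v *)
From HB Require Import structures.
From mathcomp Require Import all_boot all_order all_algebra.
From mathcomp Require Import all_classical all_reals all_analysis.
From mathcomp Require Import measurable_realfun ess_sup_inf.
From mathcomp Require Import ring lra.
Require Import Defs.

(** Write rho for the constant density L^-d and, for k in N^d, let
    gamma_k be the integral of W times the product of the cosines
    cos(2 pi k_i x_i / L) over the torus.  The ratio of W^(k) by Theta(k) is
    L^(-d/2) gamma_k, so that the claim reads: the minimum of gamma_k over k <> 0
    is attained and equals - t0, where t0 = m rho^(m-2) / beta_c.

    The idea is that the second variation of the free energy at the uniform state
    is, on the k-th Fourier component of a perturbation, proportional to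
    m rho^(m-2) / beta + gamma_k.

    - Necessity.  At beta_c the uniform state is a minimiser.  Comparing it with
      rho + s cos_k for small s gives gamma_k >= - t0 for every k <> 0
      ([uniform_minimiser_stable]).
    - No gap.  Suppose that gamma_k >= - v for all k <> 0 and some v with
      0 <= v < t0.  For beta slightly above beta_c the free energy then exceeds
      that of the uniform state by at least a multiple of the squared L^2 distance,
      uniformly on a small L^oo ball, so that the uniform state is the only
      minimiser in this ball.  Continuity of the transition
      forces the nontrivial minimisers that exist above beta_c into the ball, a
      contradiction ([continuous_no_gap]).
    - Attainment.  gamma_k tends to 0 at infinity, so only finitely many k have
      gamma_k <= - t0 / 2; as the infimum of all gamma_k with k <> 0 is - t0 < 0,
      it is attained.

    Two ingredients support this.  A quadratic expansion of t^m at rho controls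
    the entropy from both sides ([powR_le_quadratic], [powR_ge_quadratic]).  The
    interaction energy of a density r is bounded below by - v times the squared
    L^2 distance from r to rho ([interaction_form_lower_bound]): for an even
    trigonometric polynomial the energy is diagonal in the Fourier modes and
    Bessel's inequality concludes, and W is a uniform limit of such polynomials
    ([even_trigonometric_approximation]).  Working with uniform approximations
    avoids both the convergence of the Fourier series of W and the completeness
    of the trigonometric system; it also gives the measurability of W(x - y) on
    the product space and the decay of gamma_k. *)

Set Implicit Arguments.
Unset Strict Implicit.
Unset Printing Implicit Defensive.

Import Order.TTheory GRing.Theory Num.Theory.
Import numFieldNormedType.Exports.

Local Open Scope classical_set_scope.
Local Open Scope ring_scope.

(** * Quadratic expansion of real powers *)

Section powR_expansion.
Context {R : realType}.
Implicit Types m r t K : R.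

Let rem m r K t : R := t `^ m - r `^ m - m * r `^ (m - 1) * (t - r) - K / 2 * (t - r) ^+ 2.
Let drem m r K t : R := m * t `^ (m - 1) - m * r `^ (m - 1) - K * (t - r).

Let is_derive_rem m r K t : 0 < t -> is_derive t 1 (rem m r K) (drem m r K t).
Proof.
move=> t0; rewrite /rem.
have := is_derive1_powR m t0 => ?.
apply: is_derive_eq; rewrite /drem /GRing.scale /=.
by field.
Qed.

(** The difference quotient of the derivative of t^m at r tends to the second
    derivative: only the derivative of t^(m-1) at the single point r is used. *)
Lemma powR_slope m r (e : R) : 0 < r -> 0 < e ->
  exists2 d : R, 0 < d & forall t, 0 < `|t - r| < d ->
    `|(m * t `^ (m - 1) - m * r `^ (m - 1)) / (t - r) - m * (m - 1) * r `^ (m - 2)| < e.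
Proof.
move=> r0 e0.
have [dr Dr] := @is_derive1_powR R (m - 1) r r0.
have := dr => /cvg_ex[l Hl].
have El : l = (m - 1) * r `^ (m - 2).
  rewrite -[RHS]/( (m - 1) * r `^ (m - 2)) (_ : m - 2 = m - 1 - 1); last by ring.
  rewrite -Dr; apply/esym; apply/cvg_lim => //.
have e1 : 0 < e / (`|m| + 1) by rewrite divr_gt0// ltr_wpDl.
move/cvgrPdist_lt/(_ _ e1) : Hl.
rewrite near_withinE => /nbhs_ballP[d /= d0 H].
exists d => // t /andP[t0 td].
have tr : t - r != 0 by rewrite -normr_gt0.
have := H (t - r); rewrite /ball/= sub0r normrN => /(_ td tr).
rewrite /GRing.scale/= mulr1 subrK El => Hl.
set A := (X in `|X| < e); set B := (X in `|X| < _) in Hl.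
have -> : A = - m * B by rewrite /A /B; field.
rewrite normrM normrN.
apply: (@le_lt_trans _ _ ((`|m| + 1) * `|B|)); first by rewrite ler_wpM2r// lerDl.
by rewrite mulrC -ltr_pdivlMr// ltr_wpDl.
Qed.
(* By the mean value theorem the remainder is its derivative at an intermediate
   point c times t - r, and this derivative is (c - r) times a difference
   quotient minus K: since c - r and t - r have the same sign, only the sign of
   the quotient minus K matters. *)
Let rem_mvt m r K t : 0 < r -> 0 < t -> t != r ->
  exists2 c, 0 < `|c - r| <= `|t - r| &
    exists2 q, 0 < q & rem m r K t = q *
      ((m * c `^ (m - 1) - m * r `^ (m - 1)) / (c - r) - K).
Proof.
move=> r0 t0 tr.
have rem0 : rem m r K r = 0 by rewrite /rem !subrr expr0n/= !mulr0 !subr0.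
have [rt|rt] := ltP r t.
  have [||c] := @MVT R (rem m r K) (drem m r K) r t rt.
  - by move=> x /[!in_itv]/= /andP[rx _]; apply: is_derive_rem; lra.
  - apply/derivable_within_continuous => x /[!in_itv]/= /andP[rx _].
    by apply: ex_derive; apply: is_derive_rem; lra.
  move=> /[!in_itv]/= /andP[rc ct]; rewrite rem0 subr0 => ->.
  exists c; first by rewrite !gtr0_norm; lra.
  exists ((c - r) * (t - r)); first by rewrite mulr_gt0; lra.
  by rewrite /drem; field; lra.
have {}rt : t < r by rewrite lt_neqAle tr.
have [||c] := @MVT R (rem m r K) (drem m r K) t r rt.
- by move=> x /[!in_itv]/= /andP[rx _]; apply: is_derive_rem; lra.
- apply/derivable_within_continuous => x /[!in_itv]/= /andP[rx _].
  by apply: ex_derive; apply: is_derive_rem; lra.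
move=> /[!in_itv]/= /andP[tc cr]; rewrite rem0 sub0r => /eqP.
rewrite eqr_oppLR => /eqP ->.
exists c; first by rewrite !ltr0_norm; lra.
exists ((r - c) * (r - t)); first by rewrite mulr_gt0; lra.
by rewrite /drem; field; lra.
Qed.

(** The bound d <= r keeps t positive; any K above the second derivative at r
    works on a small enough neighbourhood. *)
Lemma powR_le_quadratic m r K : 0 < r -> m * (m - 1) * r `^ (m - 2) < K ->
  exists2 d : R, 0 < d <= r & forall t, `|t - r| < d ->
    t `^ m <= r `^ m + m * r `^ (m - 1) * (t - r) + K / 2 * (t - r) ^+ 2.
Proof.
move=> r0 HK; have e0 : 0 < K - m * (m - 1) * r `^ (m - 2) by lra.
have [d d0 H] := powR_slope m r0 e0.
exists (Num.min d r); first by rewrite lt_min d0 r0 ge_min lexx orbT.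
move=> t; rewrite lt_min => /andP[td tr].
have t0 : 0 < t by move: tr; rewrite ltr_norml; lra.
have [->|ne] := eqVneq t r; first by rewrite subrr expr0n/= !mulr0 !addr0.
have [c /andP[c1 c2] [q q0 Hq]] := rem_mvt m K r0 t0 ne.
suff : rem m r K t <= 0 by rewrite /rem; lra.
rewrite Hq pmulr_rle0//.
by have := H c; rewrite c1 (le_lt_trans c2 td) => /(_ isT); rewrite ltr_norml; lra.
Qed.

Lemma powR_ge_quadratic m r K : 0 < r -> K < m * (m - 1) * r `^ (m - 2) ->
  exists2 d : R, 0 < d <= r & forall t, `|t - r| < d ->
    r `^ m + m * r `^ (m - 1) * (t - r) + K / 2 * (t - r) ^+ 2 <= t `^ m.
Proof.
move=> r0 HK; have e0 : 0 < m * (m - 1) * r `^ (m - 2) - K by lra.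
have [d d0 H] := powR_slope m r0 e0.
exists (Num.min d r); first by rewrite lt_min d0 r0 ge_min lexx orbT.
move=> t; rewrite lt_min => /andP[td tr].
have t0 : 0 < t by move: tr; rewrite ltr_norml; lra.
have [->|ne] := eqVneq t r; first by rewrite subrr expr0n/= !mulr0 !addr0.
have [c /andP[c1 c2] [q q0 Hq]] := rem_mvt m K r0 t0 ne.
suff : 0 <= rem m r K t by rewrite /rem; lra.
rewrite Hq pmulr_rge0//.
by have := H c; rewrite c1 (le_lt_trans c2 td) => /(_ isT); rewrite ltr_norml; lra.
Qed.

End powR_expansion.

(** * Tensor Bernstein operators and cosine sums *)

Section bernstein.
Context {R : realType}.
Implicit Types x : R.

Definition bernstein (n : nat) x (j : nat) : R :=
  'C(n, j)%:R * x ^+ j * (1 - x) ^+ (n - j).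

Lemma bernstein_ge0 n x j : 0 <= x <= 1 -> 0 <= bernstein n x j.
Proof.
by move=> /andP[x0 x1]; rewrite /bernstein !mulr_ge0 ?exprn_ge0 ?subr_ge0.
Qed.

(** Conditioning on the first of n + 1 Bernoulli trials. *)
Lemma bernstein_recl n x (F : nat -> R) :
  \sum_(j < n.+2) bernstein n.+1 x j * F j =
  x * (\sum_(j < n.+1) bernstein n x j * F j.+1) +
  (1 - x) * (\sum_(j < n.+1) bernstein n x j * F j).
Proof.
have E1 : (1 - x) * (\sum_(j < n.+1) bernstein n x j * F j) =
    \sum_(j < n.+2) 'C(n, j)%:R * x ^+ j * (1 - x) ^+ (n.+1 - j) * F j.
  rewrite [RHS]big_ord_recr/= bin_small// !mul0r addr0 mulr_sumr.
  apply: eq_bigr => -[j /= jn] _; rewrite /bernstein subSn// exprS.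
  by ring.
rewrite E1 big_ord_recl [X in _ = _ + X]big_ord_recl /= addrCA; congr (_ + _).
  by rewrite /bernstein !bin0.
rewrite mulr_sumr -big_split/=; apply: eq_bigr => -[j /= jn] _.
by rewrite /bernstein /bump/= !add1n binS natrD subSS exprS; ring.
Qed.

Lemma bernstein_sum n x : \sum_(j < n.+1) bernstein n x j = 1.
Proof.
elim: n => [|n IHn].
  by rewrite big_ord1 /bernstein bin0 !expr0 !mulr1.
under eq_bigr do rewrite -[bernstein _ _ _]mulr1.
rewrite (bernstein_recl n x (fun=> 1)).
under eq_bigr do rewrite mulr1.
by rewrite IHn; ring.
Qed.
(** Variance of the binomial law.  The shift [c] is what makes the induction
    on the number of trials close. *)
Lemma bernstein_var n x (c : R) :
  \sum_(j < n.+1) bernstein n x j * (j%:R - n%:R * x + c) ^+ 2 =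
  n%:R * x * (1 - x) + c ^+ 2.
Proof.
elim: n c => [|n IHn] c.
  by rewrite big_ord1 /bernstein/= bin0 subnn !expr0; ring.
rewrite (bernstein_recl n x (fun j => (j%:R - n.+1%:R * x + c) ^+ 2)).
have E1 (j : nat) : j.+1%:R - n.+1%:R * x + c = j%:R - n%:R * x + (c + 1 - x).
  by rewrite -!natr1; ring.
have E2 (j : nat) : j%:R - n.+1%:R * x + c = j%:R - n%:R * x + (c - x).
  by rewrite -!natr1; ring.
under eq_bigr do rewrite E1.
rewrite IHn.
under eq_bigr do rewrite E2.
by rewrite IHn -natr1; ring.
Qed.

Context {d : nat}.
Implicit Types u : 'I_d -> R.

Definition bernstein_weight n u (j : {ffun 'I_d -> 'I_n.+1}) : R :=
  \prod_i bernstein n (u i) (j i).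

Lemma bernstein_weight_sum n u : \sum_j bernstein_weight (n:=n) u j = 1.
Proof.
rewrite /bernstein_weight -(bigA_distr_bigA (fun i (j : 'I_n.+1) => bernstein n (u i) j)).
by under eq_bigr do rewrite bernstein_sum; rewrite big1.
Qed.

(** The weights form a product law, so that the other coordinates integrate
    to 1. *)
Lemma bernstein_weight_var n u (i0 : 'I_d) :
  \sum_j bernstein_weight (n:=n.+1) u j * ((j i0)%:R / n.+1%:R - u i0) ^+ 2 =
  u i0 * (1 - u i0) / n.+1%:R.
Proof.
pose G i (j : 'I_n.+2) : R := bernstein n.+1 (u i) j *
   (if i == i0 then (j%:R / n.+1%:R - u i0) ^+ 2 else 1).
transitivity (\sum_(j : {ffun 'I_d -> 'I_n.+2}) \prod_i G i (j i)).
  apply: eq_bigr => j _; rewrite /G big_split/= /bernstein_weight; congr (_ * _).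
  by rewrite -big_mkcond/= big_pred1_eq.
rewrite -bigA_distr_bigA (bigD1 i0)//= [X in _ * X]big1 ?mulr1; last first.
  move=> i ni; rewrite /G (negbTE ni).
  by under eq_bigr do rewrite mulr1; rewrite bernstein_sum.
rewrite /G eqxx.
have := bernstein_var n.+1 (u i0) 0; rewrite expr0n addr0 => E.
have n0 : n.+1%:R != 0 :> R by rewrite pnatr_eq0.
transitivity ((\sum_(j < n.+2) bernstein n.+1 (u i0) j * (j%:R - n.+1%:R * u i0 + 0) ^+ 2) /
  n.+1%:R ^+ 2).
  rewrite mulr_suml; apply: eq_bigr => j _.
  by move: n0; move: (n.+1%:R : R) => N N0; field.
by rewrite E; move: n0; move: (n.+1%:R : R) => N N0; field.
Qed.

End bernstein.
Section cosine_span.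
Context {R : realType}.
Implicit Types (f g : R -> R) (t : R).

Definition cos_span N f := exists a : nat -> R,
  forall t, f t = \sum_(k < N) a k * cos (k%:R * t).

Lemma cos_spanD N f g : cos_span N f -> cos_span N g -> cos_span N (f \+ g).
Proof.
move=> [a fa] [b gb]; exists (a \+ b) => t.
by rewrite /= fa gb -big_split/=; apply: eq_bigr => k _; rewrite mulrDl.
Qed.

Lemma cos_spanZ N c f : cos_span N f -> cos_span N (fun t => c * f t).
Proof.
move=> [a fa]; exists (fun k => c * a k) => t.
by rewrite /= fa mulr_sumr; apply: eq_bigr => k _; rewrite mulrA.
Qed.

Lemma cos_span_basis N k : (k < N)%N -> cos_span N (fun t => cos (k%:R * t)).
Proof.
move=> kN; exists (fun j => (j == k)%:R) => t.
rewrite (bigD1 (Ordinal kN))//= eqxx mul1r big1 ?addr0// => j /negbTE.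
by rewrite -val_eqE/= => ->; rewrite mul0r.
Qed.

Lemma cos_span0 N : cos_span N (fun=> 0).
Proof. by exists (fun=> 0) => t; rewrite big1// => k _; rewrite mul0r. Qed.

(** The product formula 2 cos(kt) cos t = cos((k+1)t) + cos((k-1)t). *)
Lemma cos_span_mulcos N f : cos_span N f -> cos_span N.+1 (fun t => f t * cos t).
Proof.
move=> [a fa].
suff H M : (M <= N)%N ->
    cos_span N.+1 (fun t => (\sum_(k < M) a k * cos (k%:R * t)) * cos t).
  have [b Hb] := H N (leqnn _); exists b => t; by rewrite fa Hb.
elim: M => [_|M IH MN].
  have [b Hb] := cos_span0 N.+1; exists b => t; by rewrite big_ord0 mul0r.
have := cos_spanD (IH (ltnW MN)) (@cos_spanZ _ (a M) (fun t => cos (M%:R * t) * cos t) _).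
case=> [|b Hb].
  case: M MN {IH} => [|M MN].
    move=> N0; have [b Hb] := @cos_span_basis N.+1 1 N0.
    by exists b => t; rewrite -Hb mul0r cos0 !mul1r.
  have := cos_spanD (@cos_span_basis N.+1 M.+2 MN) (@cos_span_basis N.+1 M (ltnW (ltnW MN))).
  move/(cos_spanZ 2^-1) => [b Hb]; exists b => t; rewrite -Hb /=.
  have -> : M.+2%:R * t = M.+1%:R * t + t by rewrite -!natr1; ring.
  have -> : M%:R * t = M.+1%:R * t - t by rewrite -!natr1; ring.
  by rewrite cosD cosB; field.
by exists b => t; rewrite -Hb big_ord_recr/= mulrDl mulrA.
Qed.

Lemma cos_span_widen N f : cos_span N f -> cos_span N.+1 f.
Proof.
move=> [a fa]; exists (fun k => if (k < N)%N then a k else 0) => t.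
rewrite big_ord_recr/= ltnn mul0r addr0 fa; apply: eq_bigr => k _.
by rewrite ltn_ord.
Qed.

Lemma cos_span_affine N f (a b : R) :
  cos_span N f -> cos_span N.+1 (fun t => f t * (a + b * cos t)).
Proof.
move=> Nf; have [c Hc] := cos_spanD (cos_spanZ a (cos_span_widen Nf))
  (cos_spanZ b (cos_span_mulcos Nf)).
by exists c => t; rewrite -Hc/=; ring.
Qed.

(** A Bernstein polynomial is a product of n affine factors, each of which
    raises the degree in cos t by one. *)
Lemma cos_span_bernstein n j : (j <= n)%N ->
  cos_span n.+1 (fun t => bernstein n ((1 + cos t) / 2) j).
Proof.
move=> jn; rewrite /bernstein.
have [l ->] : exists l, n = (j + l)%N by exists (n - j)%N; rewrite subnKC.
rewrite addKn; elim: l => [|l [a Ha]]; last first.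
  have [b Hb] : cos_span (j + l.+1).+1 (fun t =>
      'C(j + l, j)%:R * ((1 + cos t) / 2) ^+ j * (1 - (1 + cos t) / 2) ^+ l *
       (2^-1 + (- 2^-1) * cos t)).
    by rewrite addnS; apply: cos_span_affine; exists a.
  have C0 : 'C(j + l, j)%:R != 0 :> R by rewrite pnatr_eq0 -lt0n bin_gt0 leq_addr.
  have [c Hc] := cos_spanZ ('C(j + l.+1, j)%:R / 'C(j + l, j)%:R) (ex_intro _ b Hb).
  by exists c => t; rewrite -Hc exprS; field.
rewrite addn0 binn; elim: j {jn} => [|j [a Ha]].
  have [b Hb] := @cos_span_basis 1 0 isT.
  by exists b => t; rewrite -Hb !expr0 mul0r cos0 !mulr1.
have [b Hb] := @cos_span_affine j.+1 _ 2^-1 2^-1 (ex_intro _ a Ha).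
by exists b => t; rewrite -Hb exprS !expr0; field.
Qed.

End cosine_span.

(** * Continuity in terms of cosines *)

Section cosine_approximation.
Context {R : realType} {d : nat}.
Implicit Types (f : 'rV[R]_d -> R).

Lemma continuous_compact_unif f (K : set 'rV[R]_d) : compact K -> continuous f ->
  forall e : R, 0 < e -> exists2 a : R, 0 < a & forall x y : 'rV[R]_d, K x ->
    (forall i, `|x 0 i - y 0 i| < a) -> `|f x - f y| < e.
Proof.
move=> cK cf e e0.
have := cK; rewrite compact_near_coveringP.
move=> /(_ R 0^'+ (fun a x => forall y : 'rV[R]_d, (forall i, `|x 0 i - y 0 i| < a) ->
  `|f x - f y| < e)).
have e20 : 0 < e / 2 by rewrite divr_gt0.
case=> [x Kx|V /= V0 H].
  have /cvgrPdist_lt/(_ _ e20) := cf x.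
  move=> /nbhs_ballP[a /= a0 H].
  have a20 : 0 < a / 2 by rewrite divr_gt0.
  exists (ball x (a / 2), [set b | b <= a / 2]).
    split; first exact: nbhsx_ballx.
    by near=> b => /=; near: b; exact: nbhs_right_le.
  move=> [x' b] /= [xx' ba] y yb.
  have Hx' : `|f x - f x'| < e / 2.
    by apply: H; apply: le_ball xx'; lra.
  have Hy : `|f x - f y| < e / 2.
    apply: H; split => // i j; rewrite !ord1.
    have [_ /(_ 0 j)] := xx'; rewrite /ball/= => h1.
    have h2 := lt_le_trans (yb j) ba.
    rewrite (_ : _ - _ = (x 0 j - x' 0 j) + (x' 0 j - y 0 j)); last by ring.
    by rewrite (le_lt_trans (ler_normD _ _))//; lra.
  rewrite (_ : _ - _ = (f x - f y) - (f x - f x')); last by ring.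
  by rewrite (le_lt_trans (ler_normB _ _))//; lra.
have V20 : 0 < V / 2 by rewrite divr_gt0.
exists (V / 2) => // x y Kx xy.
apply: (H (V / 2)) => //=.
by rewrite sub0r normrN gtr0_norm; lra.
Unshelve. all: end_near. Qed.

(** On [0, pi] the cosine separates points quantitatively, because
    cos s - cos t = 2 sin((s+t)/2) sin((t-s)/2) and the first sine dominates the
    second one. *)
Lemma cos_separated (s t a : R) : 0 <= s <= pi -> 0 <= t <= pi ->
  0 < a <= `|s - t| -> 2 * sin (a / 2) ^+ 2 <= `|cos s - cos t|.
Proof.
wlog st : s t / s <= t.
  move=> H s01 t01 H1; have [st|/ltW ts] := leP s t; first exact: H.
  by rewrite distrC; apply: H => //; rewrite distrC.
move=> /andP[s0 s1] /andP[t0 t1]; rewrite ler0_norm ?subr_le0// opprB.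
move=> /andP[a0 at_].
set p := (t - s) / 2; set q := (s + t) / 2.
have -> : cos s - cos t = 2 * (sin q * sin p).
  have -> : s = q - p by rewrite /p /q; field.
  have -> : t = q + p by rewrite /p /q; field.
  by rewrite cosB cosD; ring.
have pi0 := @pi_gt0 R.
have smono x y : 0 <= x -> x <= y -> y <= pi / 2 -> sin x <= sin y :> R.
  move=> x0 xy y1; rewrite leNgt ltr_sin -?leNgt// in_itv/=; apply/andP; split; lra.
have sap : sin (a / 2) <= sin p by apply: smono; rewrite /p; lra.
have sa0 : 0 <= sin (a / 2) by apply: sin_ge0_pi; lra.
have saq : sin (a / 2) <= sin q.
  have [q1|q1] := leP q (pi / 2); first by apply: smono => //; move: q1; rewrite /q; lra.
  have -> : sin q = sin (pi - q) by rewrite sinB sinpi cospi; ring.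
  by apply: smono; move: q1; rewrite /q; lra.
have H : sin (a / 2) * sin (a / 2) <= sin q * sin p by apply: ler_pM.
rewrite ger0_norm; first by rewrite ler_pM2l// expr2.
by rewrite mulr_ge0// mulr_ge0//; [exact: le_trans saq|exact: le_trans sap].
Qed.

Context (L : {posnum R}).
Let l : R := L%:num.

Definition angle (t : R) : R := 2 * pi * t / l.

(** A fundamental domain for the translations by L and the reflections of the
    coordinates. *)
Definition half_box : set 'rV[R]_d := [set x | forall i, 0 <= x 0 i <= l / 2].

Lemma angle_half t : 0 <= t <= l / 2 -> 0 <= angle t <= pi.
Proof.
have l0 : 0 < l by rewrite /l.
move=> /andP[t0 t1]; rewrite /angle; apply/andP; split.
  by rewrite divr_ge0 ?mulr_ge0 ?pi_ge0 ?(ltW l0).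
rewrite ler_pdivrMr// -subr_ge0 (_ : _ - _ = 2 * (pi * (l / 2 - t))); last by field.
by rewrite !mulr_ge0 ?pi_ge0 ?subr_ge0.
Qed.

Lemma compact_half_box : compact half_box.
Proof.
rewrite (_ : half_box = [set v | forall i, `[0, l / 2]%classic (v ord0 i)]).
  by apply: (@rV_compact _ _ (fun=> `[0, l / 2]%classic)) => i; exact: segment_compact.
by apply/seteqP; split => x /= H i; have := H i; rewrite in_itv.
Qed.

Lemma continuous_half_box_bounded f : continuous f ->
  exists2 M : R, 0 <= M & forall x, half_box x -> `|f x| <= M.
Proof.
move=> cf.
have : compact (f @` half_box).
  apply: continuous_compact; last exact: compact_half_box.
  exact: continuous_subspaceT.
move/compact_bounded => [M [_ HM]].
exists (`|M| + 1); first by rewrite addr_ge0.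
move=> x hx; apply: HM; last by exists x.
by rewrite (le_lt_trans (ler_norm M))// ltrDl.
Qed.

(** Either x and y are close and uniform continuity applies, or some coordinate
    differs enough for the sum of squares to dominate twice the supremum of f.
    The quadratic right-hand side is what the variance bound on the Bernstein
    weights can average. *)
Lemma cos_modulus f : continuous f -> forall e : R, 0 < e ->
  exists2 C : R, 0 <= C & forall x y : 'rV[R]_d, half_box x -> half_box y ->
    `|f x - f y| <= e + C * \sum_i (cos (angle (x 0 i)) - cos (angle (y 0 i))) ^+ 2.
Proof.
move=> cf e e0; have l0 : 0 < l by rewrite /l.
have [M M0 HM] := continuous_half_box_bounded cf.
have [a a0 Ha] := continuous_compact_unif compact_half_box cf e0.
pose a' := Num.min a (l / 2).
have a'0 : 0 < a' by rewrite lt_min a0/= divr_gt0.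
have pi0 := @pi_gt0 R.
pose c := 2 * sin (angle a' / 2) ^+ 2.
have c0 : 0 < c.
  have a'h : 0 <= a' <= l / 2 by rewrite ltW//= ge_min lexx orbT.
  have /andP[_ h] := angle_half a'h.
  rewrite mulr_gt0// exprn_gt0// sin_gt0_pi//.
  have : 0 < angle a' by rewrite divr_gt0// mulr_gt0// mulr_gt0.
  by move: h pi0; lra.
exists (2 * M / c ^+ 2); first by rewrite divr_ge0 ?sqr_ge0// mulr_ge0.
move=> x y hx hy.
have S0 i : 0 <= (cos (angle (x 0 i)) - cos (angle (y 0 i))) ^+ 2 by exact: sqr_ge0.
have [small|] := pselect (forall i, `|x 0 i - y 0 i| < a).
  rewrite (le_trans (ltW (Ha _ _ hx small)))// lerDl mulr_ge0//.
    by rewrite divr_ge0 ?sqr_ge0// mulr_ge0.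
  exact: sumr_ge0.
move/existsNP => [i /negP]; rewrite -leNgt => big.
have : c <= `|cos (angle (x 0 i)) - cos (angle (y 0 i))|.
  apply: cos_separated; [exact: angle_half|exact: angle_half|].
  have -> : angle (x 0 i) - angle (y 0 i) = 2 * pi / l * (x 0 i - y 0 i).
    by rewrite /angle; field; lra.
  have k0 : 0 < 2 * pi / l by rewrite divr_gt0 ?mulr_gt0.
  have -> : angle a' = 2 * pi / l * a' by rewrite /angle; field; lra.
  rewrite normrM (gtr0_norm k0) mulr_gt0//= ler_pM2l//.
  by rewrite (le_trans _ big)// ge_min lexx.
move=> cle.
have c2 : c ^+ 2 <= (cos (angle (x 0 i)) - cos (angle (y 0 i))) ^+ 2.
  by rewrite -[leRHS]real_normK ?num_real// ler_sqr// ?nnegrE// ltW.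
apply: (@le_trans _ _ (2 * M)).
  by rewrite (le_trans (ler_normB _ _))//; have := HM _ hx; have := HM _ hy; lra.
rewrite -[leLHS]add0r lerD//; first exact: ltW.
rewrite -mulrA ler_peMr ?mulr_ge0// mulrC ler_pdivlMr ?exprn_gt0// mul1r (le_trans c2)//.
by rewrite (bigD1 i)//= lerDl sumr_ge0.
Qed.

End cosine_approximation.

(** * Density of even trigonometric polynomials *)

Section folding.
Context {R : realType} {d : nat} (L : {posnum R}).
Let l : R := L%:num.
Let l0 : 0 < l. Proof. by rewrite /l. Qed.
Implicit Types (f : 'rV[R]_d -> R) (x : 'rV[R]_d).

Lemma fold_to_half_box (t : R) : exists s : R, exists n : int, exists b : bool,
  0 <= s <= l / 2 /\ s = (if b then - t else t) + n%:~R * l.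
Proof.
have /andP[h1 h2] := floor_itv (t / l).
set n := Num.floor (t / l) in h1 h2.
have t0 : 0 <= t - n%:~R * l by rewrite subr_ge0 -ler_pdivlMr.
have t1 : t - n%:~R * l < l.
  by move: h2; rewrite ltr_pdivrMr// intrD mulrDl mul1r; lra.
have [th|th] := leP (t - n%:~R * l) (l / 2).
  by exists (t - n%:~R * l), (- n), false; rewrite t0 th; split => //; rewrite intrN mulNr.
exists (l - (t - n%:~R * l)), (n + 1), true; split; first by apply/andP; split; lra.
by rewrite intrD; ring.
Qed.

Lemma cos_2pi_int (y : R) (n : int) : cos (y + n%:~R * (2 * pi)) = cos y.
Proof.
have P m z : cos (z + m%:R * (2 * pi)) = cos z :> R.
  rewrite -[RHS](periodicn (@cosD2pi R) m z); congr (cos (_ + _)).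
  by rewrite -[RHS]mulr_natl -[pi *+ 2]mulr_natl.
case: n => n; first exact: P.
by rewrite NegzE intrN mulNr -[LHS](P n.+1) subrK.
Qed.

Lemma cos_angle_fold (t : R) (b : bool) (n : int) :
  cos (angle L ((if b then - t else t) + n%:~R * l)) = cos (angle L t).
Proof.
have -> : angle L ((if b then - t else t) + n%:~R * l) =
    (if b then - angle L t else angle L t) + n%:~R * (2 * pi).
  by rewrite /angle -/l; case: b; field; rewrite gt_eqF.
by rewrite cos_2pi_int; case: b; rewrite ?cosN.
Qed.

Lemma row_shift (x : 'rV[R]_d) (i : 'I_d) (y c : R) :
  (\row_j (if j == i then y + c else x 0 j)) =
  (\row_j (if j == i then y else x 0 j)) + c *: delta_mx 0 i.
Proof.
apply/rowP => j; rewrite !mxE eqxx/=.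
by case: eqVneq => _; rewrite ?mulr1// mulr0 addr0.
Qed.

Lemma periodic_int f (i : 'I_d) x (n : int) : torus_periodic L f ->
  f (x + (n%:~R * l) *: delta_mx 0 i) = f x.
Proof.
move=> fper; have P m z : f (z + (m%:R * l) *: delta_mx 0 i) = f z.
  elim: m z => [|m IH] z; first by rewrite mul0r scale0r addr0.
  by rewrite -natr1 mulrDl mul1r scalerDl addrA fper IH.
case: n => n; first exact: P.
by rewrite NegzE intrN mulNr -[LHS](P n.+1) -addrA -scalerDl addNr scale0r addr0.
Qed.

Lemma fold_coordinate f x (i : 'I_d) (b : bool) (n : int) :
  torus_periodic L f -> even_coordinates f ->
  f (\row_j (if j == i then (if b then - x 0 j else x 0 j) + n%:~R * l else x 0 j)) = f x.
Proof.
move=> fper fev.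
rewrite (_ : \row_j _ = \row_j
  (if j == i then (if b then - x 0 i else x 0 i) + n%:~R * l else x 0 j)); last first.
  by apply/rowP => j; rewrite !mxE; case: eqVneq => // ->.
rewrite row_shift periodic_int//; case: b; last first.
  by congr f; apply/rowP => j; rewrite mxE; case: eqVneq => // ->.
rewrite -[RHS](fev i); congr f; apply/rowP => j; rewrite !mxE.
by case: eqVneq => // ->.
Qed.

(** The coordinates are folded one at a time, along a list. *)
Lemma fold_all f (phi : R -> R) :
  torus_periodic L f -> even_coordinates f ->
  (forall t, exists n : int, exists b : bool, phi t = (if b then - t else t) + n%:~R * l) ->
  forall x, f (\row_j phi (x 0 j)) = f x.
Proof.
move=> fper fev Hphi x.
suff H (s : seq 'I_d) : f (\row_j (if j \in s then phi (x 0 j) else x 0 j)) = f x.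
  rewrite -[RHS](H (enum 'I_d)); congr f; apply/rowP => j.
  by rewrite !mxE mem_enum.
elim: s => [|i s IH]; first by congr f; apply/rowP => j; rewrite mxE.
have [si|si] := boolP (i \in s).
  rewrite -IH; congr f; apply/rowP => j; rewrite !mxE inE.
  by case: eqVneq => // ->; rewrite si.
rewrite -IH; have [n [b Hnb]] := Hphi (x 0 i).
rewrite -[RHS](@fold_coordinate f _ i b n)//; congr f; apply/rowP => j.
rewrite !mxE inE; case: eqVneq => //= ->.
by rewrite (negbTE si) Hnb.
Qed.
(** In the variables u_i = (1 + cos(2 pi x_i / L)) / 2 an even periodic function
    is a function on the unit cube, and its tensor Bernstein polynomials converge
    to it; Bernstein polynomials in u_i are cosine sums in x_i. *)
Theorem even_trigonometric_approximation f :
  continuous f -> torus_periodic L f -> even_coordinates f ->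
  forall e : R, 0 < e ->
  exists N : nat, exists a : {ffun 'I_d -> 'I_N} -> R, forall x,
    `|f x - \sum_k a k * \prod_i cos ((k i)%:R * angle L (x 0 i))| <= e.
Proof.
move=> fc fper fev e e0; have pi0 := @pi_gt0 R.
have e20 : 0 < e / 2 by rewrite divr_gt0.
have [C C0 HC] := cos_modulus L fc e20.
have [phi Hphi] := choice fold_to_half_box.
(* Since u (1 - u) <= 1 and cos = 2 u - 1, the error coming from the variance is
   at most 4 C d / n. *)
have [n Hn] : exists n : nat, 4 * C * d%:R / (n.+1%:R) <= e / 2.
  exists (Num.bound (4 * C * d%:R / (e / 2))).
  rewrite ler_pdivrMr// [leRHS]mulrC -ler_pdivrMr//.
  have h : 0 <= 4 * C * d%:R / (e / 2) by rewrite divr_ge0 ?mulr_ge0// ltW.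
  by rewrite (le_trans (ltW (archi_boundP h)))// ler_nat.
pose node (j : 'I_n.+2) : R := l / (2 * pi) * acos (2 * (j%:R / n.+1%:R) - 1).
have n0 : 0 < n.+1%:R :> R by rewrite ltr0n.
have nodeb (j : 'I_n.+2) : -1 <= 2 * ((j%:R : R) / n.+1%:R) - 1 <= 1.
  have j0 : 0 <= j%:R / n.+1%:R :> R by rewrite divr_ge0.
  have j1 : j%:R / n.+1%:R <= 1 :> R.
    by rewrite ler_pdivrMr// mul1r ler_nat -ltnS.
  by move: j0 j1; move: (_ / _) => r r0 r1; apply/andP; split; lra.
have node_angle j : angle L (node j) = acos (2 * (j%:R / n.+1%:R) - 1).
  rewrite /angle /node -/l; move: (acos _) pi0 => z; move: (pi : R) => p p0.
  by field; rewrite !gt_eqF.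
have node_cos j : cos (angle L (node j)) = 2 * (j%:R / n.+1%:R) - 1.
  by rewrite node_angle acosK// in_itv/=.
have node_box (j : {ffun 'I_d -> 'I_n.+2}) : half_box L (\row_i node (j i)).
  move=> i; rewrite mxE /node; have := nodeb (j i) => nb.
  have a0 := acos_ge0 nb; have a1 := acos_lepi nb.
  move: (acos _) a0 a1 pi0 => z; move: (pi : R) => p z0 z1 p0; apply/andP; split.
    by apply: mulr_ge0 => //; apply: divr_ge0; [exact: ltW|apply: mulr_ge0 => //; exact: ltW].
  rewrite mulrAC ler_pdivrMr ?mulr_gt0//.
  rewrite -[L%:num]/l.   rewrite [leRHS](_ : _ = l * p); last by field.
  by rewrite ler_pM2l.
pose u x (i : 'I_d) : R := (1 + cos (angle L (x 0 i))) / 2.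
have u01 x i : 0 <= u x i <= 1.
  have := cos_le1 (angle L (x 0 i)); have := cos_geN1 (angle L (x 0 i)).
  by rewrite /u => ? ?; apply/andP; split; lra.
pose B x := \sum_(j : {ffun 'I_d -> 'I_n.+2}) bernstein_weight (u x) j * f (\row_i node (j i)).
have HB x : `|f x - B x| <= e.
  have w0 (j : {ffun 'I_d -> 'I_n.+2}) : 0 <= bernstein_weight (u x) j.
    by apply: prodr_ge0 => i _; apply: bernstein_ge0.
  set y := \row_j phi (x 0 j).
  have fy : f y = f x.
    apply: (@fold_all f phi) => // t; have [m [b [_ ->]]] := Hphi t.
    by exists m, b.
  have ybox : half_box L y.
    by move=> i; rewrite mxE; have [m [b []]] := Hphi (x 0 i).
  have ycos i : cos (angle L (y 0 i)) = 2 * u x i - 1.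
    rewrite mxE; have [m [b [_ ->]]] := Hphi (x 0 i).
    by rewrite cos_angle_fold /u; field.
  rewrite -fy -[f y]mul1r -(bernstein_weight_sum n.+1 (u x)) mulr_suml -sumrB.
  apply: (le_trans (ler_norm_sum _ _ _)).
  apply: (@le_trans _ _ (\sum_(j : {ffun 'I_d -> 'I_n.+2}) (bernstein_weight (u x) j * (e / 2)
     + 4 * C * \sum_i bernstein_weight (u x) j * ((j i)%:R / n.+1%:R - u x i) ^+ 2))).
    apply: ler_sum => j _; rewrite -mulrBr normrM ger0_norm//.
    rewrite -mulr_sumr [X in _ <= _ + X]mulrCA -mulrDr ler_wpM2l//.
    rewrite (le_trans (HC _ _ ybox (node_box j)))// lerD2l.
    rewrite [4 * C]mulrC -mulrA ler_wpM2l// mulr_sumr; apply: ler_sum => i _.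
    by rewrite ycos mxE node_cos le_eqVlt; apply/orP; left; apply/eqP; ring.
  rewrite big_split/= -mulr_suml bernstein_weight_sum mul1r -mulr_sumr exchange_big/=.
  rewrite [leRHS](splitr e) lerD2l (le_trans _ Hn)//.
  rewrite -[leRHS]mulrA ler_wpM2l ?mulr_ge0//.
  have -> : d%:R / n.+1%:R = \sum_(i < d) (n.+1%:R)^-1 :> R.
    by rewrite sumr_const card_ord mulr_natl.
  apply: ler_sum => i _; rewrite bernstein_weight_var -[leRHS]mul1r ler_wpM2r ?invr_ge0 ?ltW//.
  by have /andP[? ?] := u01 x i; nra.
have /choice[c Hc] (j : 'I_n.+2) := @cos_span_bernstein R n.+1 j (ltn_ord j).
exists n.+2; exists (fun k : {ffun 'I_d -> 'I_n.+2} => \sum_(j : {ffun 'I_d -> 'I_n.+2})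
   (\prod_i c (j i) (k i)) * f (\row_i node (j i))) => x.
rewrite (_ : \sum_k _ = B x)//.
under eq_bigr do rewrite mulr_suml.
rewrite exchange_big/=; apply: eq_bigr => j _.
rewrite /bernstein_weight /u; under [in RHS]eq_bigr do rewrite Hc.
rewrite (bigA_distr_bigA (fun i (k : 'I_n.+2) => c (j i) k * cos (k%:R * angle L (x 0 i)))).
rewrite mulr_suml; apply: eq_bigr => k _.
by rewrite big_split/=; ring.
Qed.

End folding.

(** * Integrals of bounded measurable functions on the torus *)

Section bounded_measurable.
Context {dd : measure_display} {T : measurableType dd} {R : realType}.
Implicit Types (f g : T -> R).

Definition bounded_mfun f := measurable_fun setT f /\ exists M : R, forall x, `|f x| <= M.

Lemma bounded_mfun_cst (c : R) : bounded_mfun (fun=> c).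
Proof. by split; [exact: measurable_cst|exists `|c|]. Qed.

Lemma bounded_mfunD f g : bounded_mfun f -> bounded_mfun g -> bounded_mfun (fun x => f x + g x).
Proof.
move=> [mf [M Mf]] [mg [N Ng]]; split; first exact: measurable_funD.
by exists (M + N) => x; rewrite (le_trans (ler_normD _ _))// lerD.
Qed.

Lemma bounded_mfunM f g : bounded_mfun f -> bounded_mfun g -> bounded_mfun (fun x => f x * g x).
Proof.
move=> [mf [M Mf]] [mg [N Ng]]; split; first exact: measurable_funM.
by exists (M * N) => x; rewrite normrM ler_pM.
Qed.

Lemma bounded_mfunZ c f : bounded_mfun f -> bounded_mfun (fun x => c * f x).
Proof. by move=> bf; apply: bounded_mfunM => //; exact: bounded_mfun_cst. Qed.

Lemma bounded_mfunN f : bounded_mfun f -> bounded_mfun (fun x => - f x).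
Proof.
by move=> [mf [M Mf]]; split; [exact: measurableT_comp|exists M => x; rewrite normrN].
Qed.

Lemma bounded_mfunB f g : bounded_mfun f -> bounded_mfun g -> bounded_mfun (fun x => f x - g x).
Proof. by move=> bf bg; apply: bounded_mfunD => //; exact: bounded_mfunN. Qed.

Lemma bounded_mfunX n f : bounded_mfun f -> bounded_mfun (fun x => f x ^+ n).
Proof.
move=> bf; elim: n => [|n IH]; first exact: bounded_mfun_cst.
under eq_fun do rewrite exprS; exact: bounded_mfunM.
Qed.

Lemma bounded_mfun_norm f : bounded_mfun f -> bounded_mfun (fun x => `|f x|).
Proof.
by move=> [mf [M Mf]]; split; [exact: measurableT_comp|exists M => x; rewrite normr_id].
Qed.

Lemma bounded_mfun_sum (I : Type) (s : seq I) (F : I -> T -> R) :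
  (forall i, bounded_mfun (F i)) -> bounded_mfun (fun x => \sum_(i <- s) F i x).
Proof.
move=> bF; elim: s => [|i s IH].
  by under eq_fun do rewrite big_nil; exact: bounded_mfun_cst.
by under eq_fun do rewrite big_cons; exact: bounded_mfunD.
Qed.

Lemma bounded_mfun_prod (I : Type) (s : seq I) (F : I -> T -> R) :
  (forall i, bounded_mfun (F i)) -> bounded_mfun (fun x => \prod_(i <- s) F i x).
Proof.
move=> bF; elim: s => [|i s IH].
  by under eq_fun do rewrite big_nil; exact: bounded_mfun_cst.
by under eq_fun do rewrite big_cons; exact: bounded_mfunM.
Qed.

End bounded_measurable.

Lemma bounded_mfun_comp d1 d2 (T1 : measurableType d1) (T2 : measurableType d2) (R : realType)
  (f : T2 -> R) (g : T1 -> T2) : measurable_fun setT g -> bounded_mfun f ->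
    bounded_mfun (fun x => f (g x)).
Proof.
move=> mg [mf [M Mf]]; split; first exact: measurableT_comp.
by exists M => x.
Qed.

Section bounded_integral.
Context {dd : measure_display} {T : measurableType dd} {R : realType}.
Variable mu : {measure set T -> \bar R}.
Hypothesis mufin : (mu setT < +oo)%E.
Implicit Types (f g : T -> R).

Lemma bounded_mfun_integrable f : bounded_mfun f -> mu.-integrable setT (EFin \o f).
Proof.
move=> [mf [M Mf]]; apply: measurable_bounded_integrable => //.
exists M; split; first exact: num_real.
by move=> x Mx y _ /=; rewrite (le_trans (Mf y))// ltW.
Qed.

Lemma bounded_mfun_fineK f : bounded_mfun f ->
  (\int[mu]_x (f x)%:E)%E = (\int[mu]_x f x)%:E.
Proof.
move=> bf; rewrite /Rintegral fineK//; apply: integrable_fin_num => //.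
exact: bounded_mfun_integrable.
Qed.

Lemma RintD f g : bounded_mfun f -> bounded_mfun g ->
  \int[mu]_x (f x + g x) = \int[mu]_x f x + \int[mu]_x g x.
Proof. by move=> bf bg; rewrite RintegralD//; exact: bounded_mfun_integrable. Qed.

Lemma RintB f g : bounded_mfun f -> bounded_mfun g ->
  \int[mu]_x (f x - g x) = \int[mu]_x f x - \int[mu]_x g x.
Proof. by move=> bf bg; rewrite RintegralB//; exact: bounded_mfun_integrable. Qed.

Lemma RintZ c f : bounded_mfun f -> \int[mu]_x (c * f x) = c * \int[mu]_x f x.
Proof. by move=> bf; rewrite RintegralZl//; exact: bounded_mfun_integrable. Qed.

Lemma Rint_cst (c : R) : \int[mu]_x c = c * fine (mu setT).
Proof. by rewrite Rintegral_cst. Qed.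

Lemma Rint_sum (I : Type) (s : seq I) (F : I -> T -> R) : (forall i, bounded_mfun (F i)) ->
  \int[mu]_x (\sum_(i <- s) F i x) = \sum_(i <- s) \int[mu]_x F i x.
Proof.
move=> bF; elim: s => [|i s IH].
  by under eq_Rintegral do rewrite big_nil; rewrite Rint_cst mul0r big_nil.
under eq_Rintegral do rewrite big_cons.
by rewrite RintD ?IH ?big_cons//; exact: bounded_mfun_sum.
Qed.

Lemma le_Rint f g : bounded_mfun f -> bounded_mfun g -> (forall x, f x <= g x) ->
  \int[mu]_x f x <= \int[mu]_x g x.
Proof. by move=> bf bg fg; apply: le_Rintegral => //; exact: bounded_mfun_integrable. Qed.

Lemma Rint_norm_le f : bounded_mfun f -> `|\int[mu]_x f x| <= \int[mu]_x `|f x|.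
Proof. by move=> bf; apply: le_normr_Rintegral => //; exact: bounded_mfun_integrable. Qed.

End bounded_integral.

Section product_integral.
Context {d1 d2 : measure_display} {T1 : measurableType d1} {T2 : measurableType d2}
  {R : realType}.
Variables (m1 : {finite_measure set T1 -> \bar R})
          (m2 : {finite_measure set T2 -> \bar R}).

Lemma product_measure_lty : ((m1 \x m2)%E setT < +oo)%E.
Proof.
by rewrite -setXTT product_measure1E// lte_mul_pinfty ?ge0_fin_numE// ?ltey_eq
  fin_num_measure.
Qed.

Lemma Rint_product f g : bounded_mfun f -> bounded_mfun g ->
  \int[(m1 \x m2)%E]_z (f z.1 * g z.2) = \int[m1]_x f x * \int[m2]_y g y.
Proof.
move=> bf bg.
have bfg : bounded_mfun (fun z : T1 * T2 => f z.1 * g z.2).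
  by apply: bounded_mfunM; apply: bounded_mfun_comp.
have m1f : (m1 setT < +oo)%E by rewrite ltey_eq fin_num_measure.
have m2f : (m2 setT < +oo)%E by rewrite ltey_eq fin_num_measure.
have ifg := bounded_mfun_integrable product_measure_lty bfg.
rewrite {1}/Rintegral -(integral12_prod_meas1 ifg) /fubini_F /=.
rewrite (eq_integral (fun x => ((\int[m2]_y g y) * f x)%:E)); last first.
  by move=> x _; rewrite bounded_mfun_fineK ?RintZ//; [rewrite mulrC|exact: bounded_mfunZ].
rewrite -/(Rintegral m1 setT (fun x => (\int[m2]_y g y) * f x)).
by rewrite RintZ// mulrC.
Qed.

End product_integral.

Section torus_integral.
Context {R : realType} (L : {posnum R}).
Let l : R := L%:num.
Let l0 : 0 < l. Proof. by rewrite /l. Qed.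

Lemma torus_lty d : (torus_measure L d setT < +oo)%E.
Proof. by rewrite torus_measureT ltry. Qed.

Lemma circle_lty : (circle_measure L setT < +oo)%E.
Proof. by rewrite circle_measureT ltry. Qed.

Lemma bounded_mfun_coordinate d (i : 'I_d) (f : R -> R) :
  bounded_mfun (f : measurableTypeR R -> R) -> bounded_mfun (fun x : space R d => f (tnth x i)).
Proof. by apply: bounded_mfun_comp; exact: measurable_tnth. Qed.

(** The torus measure is built by adding one coordinate at a time, so Fubini
    applies inductively. *)
Lemma Rint_torus_prod d (f : 'I_d -> R -> R) :
  (forall i, bounded_mfun (f i : measurableTypeR R -> R)) ->
  \int[torus_measure L d]_x (\prod_i f i (tnth x i)) =
  \prod_i \int[circle_measure L]_t f i t.
Proof.
elim: d f => [|d IH] f bf.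
  under eq_Rintegral do rewrite big_ord0.
  rewrite big_ord0; transitivity (1 * fine (torus_measure L 0 setT)); first exact: Rint_cst.
  by rewrite torus_measureT/= mul1r expr0.
have bF : bounded_mfun (fun x : space R d.+1 => \prod_i f i (tnth x i)).
  by apply: bounded_mfun_prod => i; exact: bounded_mfun_coordinate.
have bG : bounded_mfun (fun x : space R d => \prod_i f (lift ord0 i) (tnth x i)).
  by apply: bounded_mfun_prod => i; apply: bounded_mfun_coordinate.
rewrite /Rintegral /= /cons_measure.
rewrite integral_pushforward//=; last 2 first.
- by apply/measurable_EFinP; case: bF.
- rewrite preimage_setT.
  apply: (bounded_mfun_integrable (product_measure_lty _ _)
    (f := fun z => \prod_i f i (tnth (tuple_cons z) i))).
  apply: (bounded_mfun_comp (f := fun x : space R d.+1 => \prod_i f i (tnth x i)) _ bF).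
  exact: measurable_tuple_cons.
rewrite preimage_setT big_ord_recl -(IH (fun i => f (lift ord0 i)))//.
rewrite -[RHS](Rint_product (circle_measure L) (torus_measure L d) (bf ord0) bG).
congr fine; apply: eq_integral => z _ /=; rewrite big_ord_recl/=; congr (_ * _)%:E.
by apply: eq_bigr => i _; rewrite tnthS.
Qed.

(** The end point L has measure zero; the closed interval is the one to which
    the fundamental theorem of calculus applies. *)
Lemma Rint_circle (f : R -> R) : bounded_mfun (f : measurableTypeR R -> R) ->
  \int[circle_measure L]_t f t =
  fine (\int[lebesgue_measure]_(t in `[0%R, l]) (f t)%:E)%E.
Proof.
move=> bf; rewrite /Rintegral; congr fine.
have mf : measurable_fun setT (EFin \o (f : measurableTypeR R -> R)).
  by apply/measurable_EFinP; case: bf.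
rewrite (negligible_integral (N := ~` circle_dom L))//; first last.
- rewrite /circle_measure /mfrestr /mrestr -[RHS](measure0 (@lebesgue_measure R)).
  by congr (lebesgue_measure _); exact: setICl.
- exact: (bounded_mfun_integrable circle_lty bf).
- by apply: measurableC; exact: measurable_circle_dom.
rewrite setDE setTI setCK -integral_itv_bndo_bndc; last first.
  exact: measurable_funTS.
apply: eq_measure_integral => A mA AD.
rewrite /circle_measure /mfrestr /mrestr.
by congr (lebesgue_measure _); apply: setIidl.
Qed.

End torus_integral.

(** * Orthogonality of the trigonometric modes *)

Section circle_trigonometry.
Context {R : realType} (L : {posnum R}).
Let l : R := L%:num.
Let l0 : 0 < l. Proof. by rewrite /l. Qed.

Let is_derive_sin_lin (c x : R) : is_derive x 1 (fun t : R => sin (c * t)) (c * cos (c * x)).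
Proof.
have h : is_derive x 1 (fun t : R => c * t) c.
  by apply: is_derive_eq; rewrite /GRing.scale/= mulr1.
have := @is_derive1_comp _ (@sin R) (fun t => c * t) x _ _ _ h.
by move=> /(_ _ (is_derive_sin _)) H; apply: (is_derive_eq H); rewrite mulrC.
Qed.

Let is_derive_cos_lin (c x : R) : is_derive x 1 (fun t : R => cos (c * t)) (- c * sin (c * x)).
Proof.
have h : is_derive x 1 (fun t : R => c * t) c.
  by apply: is_derive_eq; rewrite /GRing.scale/= mulr1.
have := @is_derive1_comp _ (@cos R) (fun t => c * t) x _ _ _ h.
by move=> /(_ _ (is_derive_cos _)) H; apply: (is_derive_eq H); ring.
Qed.

Let FTC (f F : R -> R) : (forall x : R, {for x, continuous f}) ->
  (forall x : R, is_derive x 1 F (f x)) -> F 0 = F l ->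
  fine (\int[lebesgue_measure]_(t in `[0%R, l]) (f t)%:E)%E = 0.
Proof.
move=> cf dF F0l.
have cF x : {for x, continuous F}.
  apply: differentiable_continuous; apply/derivable1_diffP.
  by have [] := dF x.
rewrite (@continuous_FTC2 _ f F)//=.
- by rewrite F0l subrr.
- exact: continuous_subspaceT.
- split.
  + by move=> x _; have [] := dF x.
  + exact/cvg_at_right_filter/cF.
  + exact/cvg_at_left_filter/cF.
- by move=> x _; rewrite derive1E; have [_ ->] := dF x.
Qed.

Definition trig (b : bool) (k : nat) (t : R) : R :=
  if b then sin (k%:R * angle L t) else cos (k%:R * angle L t).

Let bounded_mfun_trig_int (b : bool) (n : int) :
  bounded_mfun ((fun t => if b then sin (n%:~R * angle L t) else cos (n%:~R * angle L t))
       : measurableTypeR R -> R).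
Proof.
split; last first.
  by exists 1 => t; case: b; rewrite ler_norml ?sin_geN1 ?sin_le1 ?cos_geN1 ?cos_le1.
apply: continuous_measurable_fun => x.
have -> : (fun t => if b then sin (n%:~R * angle L t) else cos (n%:~R * angle L t)) =
  (fun t => if b then sin (n%:~R * 2 * pi / l * t) else cos (n%:~R * 2 * pi / l * t)).
  apply/funext => t; rewrite (_ : n%:~R * 2 * pi / l * t = n%:~R * angle L t)//.
  by rewrite /angle -/l; ring.
apply: differentiable_continuous; apply/derivable1_diffP.
by case: b; [have [] := is_derive_sin_lin (n%:~R * 2 * pi / l) x|
             have [] := is_derive_cos_lin (n%:~R * 2 * pi / l) x].
Qed.

Lemma bounded_mfun_trig b k : bounded_mfun (trig b k : measurableTypeR R -> R).
Proof. exact: (bounded_mfun_trig_int b (Posz k)). Qed.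

Let Rint_cos_int (n : int) : n != 0 ->
  \int[circle_measure L]_t cos (n%:~R * angle L t) = 0.
Proof.
move=> n0; have n0R : n%:~R != 0 :> R by rewrite intr_eq0.
have pi0 := @pi_gt0 R.
rewrite (Rint_circle L (bounded_mfun_trig_int false n)).
pose c := n%:~R * 2 * pi / l.
have c0 : c != 0 by rewrite /c !mulf_neq0 ?invr_neq0// ?gt_eqF.
have E t : n%:~R * angle L t = c * t by rewrite /c /angle -/l; ring.
under eq_integral do rewrite E.
apply: (@FTC _ (fun t => c^-1 * sin (c * t))).
- move=> x; apply: differentiable_continuous; apply/derivable1_diffP.
  by have [] := is_derive_cos_lin c x.
- move=> x; have h := is_derive_sin_lin c x.
  by apply: is_derive_eq; rewrite /GRing.scale/= mulrA mulVf ?mul1r.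
- congr (_ * _); rewrite mulr0 sin0 -cosBpihalf.
  have -> : c * l - pi / 2 = - (pi / 2) + n%:~R * (2 * pi).
    by rewrite /c; move: (pi : R) => p; field; rewrite gt_eqF.
  by rewrite cos_2pi_int cosN cos_pihalf.
Qed.

Let Rint_sin_int (n : int) : \int[circle_measure L]_t sin (n%:~R * angle L t) = 0.
Proof.
have [->|n0] := eqVneq n 0.
  under eq_Rintegral do rewrite mul0r sin0.
  by rewrite Rint_cst ?mul0r// circle_lty.
have n0R : n%:~R != 0 :> R by rewrite intr_eq0.
have pi0 := @pi_gt0 R.
rewrite (Rint_circle L (bounded_mfun_trig_int true n)).
pose c := n%:~R * 2 * pi / l.
have c0 : c != 0 by rewrite /c !mulf_neq0 ?invr_neq0// ?gt_eqF.
have E t : n%:~R * angle L t = c * t by rewrite /c /angle -/l; ring.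
under eq_integral do rewrite E.
apply: (@FTC _ (fun t => - c^-1 * cos (c * t))).
- move=> x; apply: differentiable_continuous; apply/derivable1_diffP.
  by have [] := is_derive_sin_lin c x.
- move=> x; have h := is_derive_cos_lin c x.
  by apply: is_derive_eq; rewrite /GRing.scale/=; field.
- congr (_ * _); rewrite mulr0.
  have -> : c * l = 0 + n%:~R * (2 * pi).
    by rewrite /c; move: (pi : R) => p; field; rewrite gt_eqF.
  by rewrite cos_2pi_int.
Qed.

Let Ci (n : int) : \int[circle_measure L]_t cos (n%:~R * angle L t) = (n == 0)%:R * l.
Proof.
have [->|n0] := eqVneq n 0; last by rewrite mul0r Rint_cos_int.
under eq_Rintegral do rewrite mul0r cos0.
rewrite Rint_cst ?circle_lty//.
congr (_ * _); rewrite -[LHS]/(fine (circle_measure L setT)).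
by rewrite circle_measureT.
Qed.

Let Rint_lin (f g : R -> R) (a : R) :
  bounded_mfun (f : measurableTypeR R -> R) -> bounded_mfun (g : measurableTypeR R -> R) ->
  \int[circle_measure L]_t (2^-1 * (f t + a * g t)) =
  2^-1 * (\int[circle_measure L]_t f t + a * \int[circle_measure L]_t g t).
Proof.
move=> bf bg; have fin := circle_lty L.
by rewrite RintZ ?RintD ?RintZ//;
  [exact: bounded_mfunZ|apply: bounded_mfunD => //; exact: bounded_mfunZ].
Qed.

Let trig_add (j k : nat) t : (j%:Z + k%:Z)%:~R * angle L t = j%:R * angle L t + k%:R * angle L t.
Proof. by rewrite intrD mulrDl. Qed.
Let trig_sub (j k : nat) t : (j%:Z - k%:Z)%:~R * angle L t = j%:R * angle L t - k%:R * angle L t.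
Proof. by rewrite intrB mulrBl. Qed.

Definition trig_sqnorm (b : bool) (k : nat) : R :=
  if k == 0%N then (~~ b)%:R * l else l / 2.

(** The product formulas reduce this to the integrals of the sine and cosine of
    integer multiples of the angle, where frequency 0 occurs only for j = k, or for
    j = k = 0 in the sums j + k. *)
Lemma Rint_trigM b c j k : \int[circle_measure L]_t (trig b j t * trig c k t) =
  ((b == c) && (j == k))%:R * trig_sqnorm b j.
Proof.
have bc n : bounded_mfun ((fun t => cos (n%:~R * angle L t)) : measurableTypeR R -> R) :=
  bounded_mfun_trig_int false n.
have bs n : bounded_mfun ((fun t => sin (n%:~R * angle L t)) : measurableTypeR R -> R) :=
  bounded_mfun_trig_int true n.
have jk0 : (j%:Z - k%:Z == 0) = (j == k) by rewrite subr_eq0.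
have jk1 : (j%:Z + k%:Z == 0) = (j == 0%N) && (k == 0%N).
  by rewrite -PoszD -addn_eq0.
have sum0 : (j == 0%N) && (k == 0%N) = (j == k) && (j == 0%N).
  by case: eqVneq => [->|]; rewrite ?andbF// andbT eq_sym.
rewrite /trig /trig_sqnorm; case: b; case: c => /=.
- transitivity (\int[circle_measure L]_t (2^-1 * (cos ((j%:Z - k%:Z)%:~R * angle L t) +
      (-1) * cos ((j%:Z + k%:Z)%:~R * angle L t)))).
    by apply: eq_Rintegral => t _; rewrite trig_add trig_sub cosB cosD; field.
  rewrite Rint_lin// !Ci jk0 jk1 sum0.
  by case: (j == k); case: (j == 0%N) => /=; rewrite -/l; field.
- transitivity (\int[circle_measure L]_t (2^-1 * (sin ((j%:Z + k%:Z)%:~R * angle L t) +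
      1 * sin ((j%:Z - k%:Z)%:~R * angle L t)))).
    by apply: eq_Rintegral => t _; rewrite trig_add trig_sub sinB sinD; field.
  by rewrite Rint_lin// !Rint_sin_int; ring.
- transitivity (\int[circle_measure L]_t (2^-1 * (sin ((j%:Z + k%:Z)%:~R * angle L t) +
      (-1) * sin ((j%:Z - k%:Z)%:~R * angle L t)))).
    by apply: eq_Rintegral => t _; rewrite trig_add trig_sub sinB sinD; field.
  by rewrite Rint_lin// !Rint_sin_int; ring.
- transitivity (\int[circle_measure L]_t (2^-1 * (cos ((j%:Z - k%:Z)%:~R * angle L t) +
      1 * cos ((j%:Z + k%:Z)%:~R * angle L t)))).
    by apply: eq_Rintegral => t _; rewrite trig_add trig_sub cosB cosD; field.
  rewrite Rint_lin// !Ci jk0 jk1 sum0.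
  by case: (j == k); case: (j == 0%N) => /=; rewrite -/l; field.
Qed.

End circle_trigonometry.

Section torus_trigonometry.
Context {R : realType} (L : {posnum R}) (d : nat).
Let l : R := L%:num.
Let l0 : 0 < l. Proof. by rewrite /l. Qed.
Let mu := torus_measure L d.
Let mufin : (mu setT < +oo)%E. Proof. exact: torus_lty. Qed.

(** The product of sines (where b holds) and cosines.  A mode with a sine of
    frequency 0 vanishes identically; keeping these modes makes the addition
    formula a plain sum over all b. *)
Definition trig_mode (b : 'I_d -> bool) (k : 'I_d -> nat) (x : space R d) : R :=
  \prod_i trig L (b i) (k i) (tnth x i).

Lemma bounded_mfun_trig_mode b k : bounded_mfun (trig_mode b k).
Proof. by apply: bounded_mfun_prod => i; apply: bounded_mfun_coordinate;
  exact: bounded_mfun_trig. Qed.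

Definition trig_mode_sqnorm (b : 'I_d -> bool) (k : 'I_d -> nat) : R :=
  \prod_i trig_sqnorm L (b i) (k i).
(** The inverse of the squared norm of the nonzero modes of frequency k, that is
    the square of the normalisation constant N_k. *)
Definition mode_weight (k : 'I_d -> nat) : R :=
  \prod_i ((2 - (k i == 0%N)%:R) / l).

Lemma mode_weight_gt0 k : 0 < mode_weight k.
Proof.
apply: prodr_gt0 => i _; rewrite divr_gt0//.
by case: (k i == 0%N); rewrite ?subr0// (_ : 2 - 1 = 1 :> R)//; ring.
Qed.

Lemma trig_mode_sqnorm_cos k : trig_mode_sqnorm (fun=> false) k = (mode_weight k)^-1.
Proof.
rewrite /trig_mode_sqnorm /mode_weight -prodfV; apply: eq_bigr => i _.
rewrite /trig_sqnorm -/l; case: eqP => _ /=; field; rewrite ?gt_eqF//.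
Qed.

Lemma trig_mode_sqnorm_le b k : mode_weight k * trig_mode_sqnorm b k <= 1.
Proof.
rewrite -big_split/=; apply: (@le_trans _ _ (\prod_(i < d) (1 : R))); last by rewrite big1.
apply: ler_prod => i _; rewrite /trig_sqnorm -/l.
have e : l / l = 1 by rewrite divff// gt_eqF.
case: eqP => _ /=; last first.
  by rewrite subr0 (_ : _ * _ = 1) ?ler01 ?lexx//; field; rewrite gt_eqF.
case: (b i); rewrite /= ?mul0r ?mulr0 ?lexx ?ler01//.
by rewrite (_ : _ * _ = 1) ?ler01 ?lexx//; field; rewrite gt_eqF.
Qed.

Lemma Rint_trig_modeM b c j k : \int[mu]_x (trig_mode b j x * trig_mode c k x) =
  ([forall i, b i == c i] && [forall i, j i == k i])%:R * trig_mode_sqnorm b j.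
Proof.
under eq_Rintegral do rewrite -big_split/=.
rewrite (Rint_torus_prod L (f := fun i t => trig L (b i) (j i) t * trig L (c i) (k i) t));
  last first.
  by move=> i; apply: bounded_mfunM; exact: bounded_mfun_trig.
under eq_bigr do rewrite Rint_trigM.
rewrite big_split/=; congr (_ * _).
case: andP => [[/forallP bc /forallP jk]|H].
  by rewrite big1// => i _; rewrite bc jk.
have [i Hi] : exists i, ~~ ((b i == c i) && (j i == k i)).
  apply/existsP; rewrite -negb_forall; apply/negP => /forallP h; apply: H; split.
    by apply/forallP => i; have /andP[] := h i.
  by apply/forallP => i; have /andP[] := h i.
by rewrite (bigD1 i)//= (negbTE Hi) mul0r.
Qed.

End torus_trigonometry.

(** * The interaction energy of trigonometric polynomials *)

(** For estimates obtained from uniform approximations, whose errors are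
    multiples of an arbitrary precision. *)
Lemma le_eps_mul {R : realType} (x y K : R) : 0 <= K ->
  (forall e, 0 < e -> x <= y + e * K) -> x <= y.
Proof.
move=> K0 H; apply/ler_addgt0Pr => e e0.
have K1 : 0 < K + 1 by rewrite ltr_wpDl.
have := H (e / (K + 1)) (divr_gt0 e0 K1) => /le_trans; apply.
rewrite lerD2l mulrAC ler_pdivrMr// ler_pM2l//; lra.
Qed.

Lemma eq_eps_mul {R : realType} (x y K : R) : 0 <= K ->
  (forall e, 0 < e -> `|x - y| <= e * K) -> x = y.
Proof.
move=> K0 H; apply/eqP; rewrite eq_le; apply/andP; split; apply: (le_eps_mul K0) => e e0.
  by have := H e e0; rewrite ler_norml => /andP[_]; lra.
by have := H e e0; rewrite ler_norml => /andP[]; lra.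
Qed.

(** Used with trigonometric polynomials as approximants, this makes W(x - y)
    measurable for the product sigma-algebra on tuples although W is only known
    to be continuous for the topology of row vectors. *)
Lemma bounded_mfun_approx dd (T : measurableType dd) (R : realType) (f : T -> R) :
  (forall e : R, 0 < e -> exists2 g : T -> R, bounded_mfun g & forall x, `|f x - g x| <= e) ->
  bounded_mfun f.
Proof.
move=> H.
have inv0 (n : nat) : 0 < (n.+1%:R)^-1 :> R by rewrite invr_gt0.
have /choice[g Hg] (n : nat) : exists g : T ->
  R, bounded_mfun g /\ forall x, `|f x - g x| <= (n.+1%:R)^-1.
  by have [g bg gf] := H _ (inv0 n); exists g.
split.
  apply: (@measurable_fun_cvg _ _ _ _ g) => [n|x _]; first by have [[]] := Hg n.
  apply/cvgrPdist_le => e e0.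
  near=> n; have [_ /(_ x) /le_trans] := Hg n; apply.
  by apply/ltW; near: n; exact: (near_infty_natSinv_lt (PosNum e0)).
have [g1 [_ [M gM]] fg] := H 1 ltr01.
exists (1 + M) => x; rewrite -[f x](subrK (g1 x)) (le_trans (ler_normD _ _))//.
exact: lerD.
Unshelve. all: end_near. Qed.

Section interaction_energy.
Context {R : realType} (L : {posnum R}) (d : nat).
Let l : R := L%:num.
Let l0 : 0 < l. Proof. by rewrite /l. Qed.
Let mu := torus_measure L d.
Let mufin : (mu setT < +oo)%E. Proof. exact: torus_lty. Qed.
Let mu2fin : ((mu \x mu)%E setT < +oo)%E. Proof. exact: product_measure_lty. Qed.
Implicit Types (f : 'rV[R]_d -> R) (r : space R d -> R) (k : 'I_d -> nat).

Definition trig_poly N (a : {ffun 'I_d -> 'I_N} -> R) (x : 'rV[R]_d) : R :=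
  \sum_k a k * \prod_i cos ((k i)%:R * angle L (x 0 i)).

Definition trig_approximable f := forall e : R, 0 < e ->
  exists N, exists a : {ffun 'I_d -> 'I_N} -> R, forall x, `|f x - trig_poly a x| <= e.

Definition cosine_coef f k : R := \int[mu]_x (f (vec x) * trig_mode L (fun=> false) k x).

Definition interaction_form f r : R :=
  \int[(mu \x mu)%E]_z (f (vec z.1 - vec z.2) * r z.1 * r z.2).

Section polynomial.
Context (N : nat) (a : {ffun 'I_d -> 'I_N} -> R).
Let p := trig_poly a.

Lemma trig_poly_vec x : p (vec x) = \sum_k a k * trig_mode L (fun=> false) (fun i => k i) x.
Proof.
apply: eq_bigr => k _; congr (_ * _); apply: eq_bigr => i _.
by rewrite mxE.
Qed.

(** The addition formula cos(s - t) = cos s cos t + sin s sin t, expanded over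
    the coordinates, separates the variables x and y. *)
Lemma trig_poly_vecB x y : p (vec x - vec y) = \sum_k a k *
  \sum_(b : {ffun 'I_d -> bool}) trig_mode L b (fun i => k i) x * trig_mode L b (fun i => k i) y.
Proof.
apply: eq_bigr => k _; congr (_ * _).
under [RHS]eq_bigr do rewrite -big_split/=.
rewrite -(bigA_distr_bigA
  (fun i (b : bool) => trig L b (k i) (tnth x i) * trig L b (k i) (tnth y i))).
apply: eq_bigr => i _; rewrite big_bool !mxE /trig.
rewrite (_ : angle L _ = angle L (tnth x i) - angle L (tnth y i)).
  by rewrite mulrBr cosB addrC.
by rewrite /angle -/l; field; rewrite gt_eqF.
Qed.

Lemma bounded_mfun_trig_poly : bounded_mfun (fun x : space R d => p (vec x)).
Proof.
under eq_fun do rewrite trig_poly_vec.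
by apply: bounded_mfun_sum => k; apply: bounded_mfunZ; exact: bounded_mfun_trig_mode.
Qed.

Lemma bounded_mfun_trig_polyB :
  bounded_mfun (fun z : space R d * space R d => p (vec z.1 - vec z.2)).
Proof.
under eq_fun do rewrite trig_poly_vecB.
apply: bounded_mfun_sum => k; apply: bounded_mfunZ; apply: bounded_mfun_sum => b.
apply: bounded_mfunM; first exact:
  (bounded_mfun_comp measurable_fst (bounded_mfun_trig_mode L _ _)).
exact: (bounded_mfun_comp measurable_snd (bounded_mfun_trig_mode L _ _)).
Qed.

(** The interaction energy is diagonal in the Fourier modes of the density. *)
Lemma interaction_form_trig_poly r : bounded_mfun r -> interaction_form p r =
  \sum_k a k * \sum_(b : {ffun 'I_d -> bool})
    (\int[mu]_x (trig_mode L b (fun i => k i) x * r x)) ^+ 2.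
Proof.
move=> br; rewrite /interaction_form.
have bt b k : bounded_mfun (fun x : space R d => trig_mode L b k x * r x).
  by apply: bounded_mfunM => //; exact: bounded_mfun_trig_mode.
pose G b k (z : space R d * space R d) :=
  (trig_mode L b k z.1 * r z.1) * (trig_mode L b k z.2 * r z.2).
have bG b k : bounded_mfun (G b k).
  apply: bounded_mfunM; first exact: (bounded_mfun_comp measurable_fst (bt b k)).
  exact: (bounded_mfun_comp measurable_snd (bt b k)).
transitivity (\int[(mu \x mu)%E]_z
  (\sum_(k : {ffun 'I_d -> 'I_N}) a k * \sum_(b : {ffun 'I_d -> bool}) G b (fun i => k i) z)).
  apply: eq_Rintegral => z _; rewrite trig_poly_vecB -mulrA mulr_suml.
  apply: eq_bigr => k _; rewrite -mulrA mulr_suml; congr (_ * _).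
  by apply: eq_bigr => b _; rewrite /G; ring.
rewrite Rint_sum//; last by move=> k; apply: bounded_mfunZ; apply: bounded_mfun_sum => b.
apply: eq_bigr => k _; rewrite RintZ//; last exact: bounded_mfun_sum.
rewrite Rint_sum//; congr (_ * _); apply: eq_bigr => b _.
by rewrite expr2 -(Rint_product mu mu (bt _ _) (bt _ _)).
Qed.

Definition same_freq k j := [forall i, k i == j i].

Lemma cosine_coef_trig_poly k0 : cosine_coef p k0 =
  \sum_k a k * ((same_freq (fun i => k i) k0)%:R / mode_weight L k0).
Proof.
rewrite /cosine_coef.
have bt (k : {ffun 'I_d -> 'I_N}) : bounded_mfun (fun x : space R d =>
    trig_mode L (fun=> false) (fun i => k i) x * trig_mode L (fun=> false) k0 x).
  by apply: bounded_mfunM; exact: bounded_mfun_trig_mode.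
transitivity (\int[mu]_x (\sum_k a k *
    (trig_mode L (fun=> false) (fun i => k i) x * trig_mode L (fun=> false) k0 x))).
  apply: eq_Rintegral => x _; rewrite trig_poly_vec mulr_suml.
  by apply: eq_bigr => k _; rewrite mulrA.
rewrite Rint_sum//; last by move=> k; exact: bounded_mfunZ.
apply: eq_bigr => k _; rewrite RintZ// Rint_trig_modeM; congr (_ * _).
rewrite andb_idl; last by move=> _; apply/forallP => i; exact: eqxx.
rewrite /same_freq; case: forallP => [kk0|_]; last by rewrite !mul0r.
rewrite !mul1r trig_mode_sqnorm_cos; congr (_^-1); apply: eq_bigr => i _.
by rewrite (eqP (kk0 i)).
Qed.

(** Fourier inversion for trigonometric polynomials, by orthogonality. *)
Lemma trig_poly_coef (k : {ffun 'I_d -> 'I_N}) : a k =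
  mode_weight L (fun i => k i) * cosine_coef p (fun i => k i).
Proof.
rewrite cosine_coef_trig_poly (bigD1 k)//= (_ : same_freq _ _ = true); last by apply/forallP.
rewrite big1 ?addr0 => [|j jk].
  by rewrite mul1r mulrCA divff ?mulr1// gt_eqF// mode_weight_gt0.
case: (boolP (same_freq _ _)) => [/forallP h|_]; last by rewrite mul0r mulr0.
suff jk' : j = k by rewrite jk' eqxx in jk.
by apply/ffunP => i; apply/val_inj/eqP/h.
Qed.

End polynomial.

End interaction_energy.

(** * Spectral bounds for the interaction energy *)

Section interaction_form_estimates.
Context {R : realType} (L : {posnum R}) (d : nat).
Let l : R := L%:num.
Let l0 : 0 < l. Proof. by rewrite /l. Qed.
Let mu := torus_measure L d.
Let mufin : (mu setT < +oo)%E. Proof. exact: torus_lty. Qed.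
Let mu2fin : ((mu \x mu)%E setT < +oo)%E. Proof. exact: product_measure_lty. Qed.
Implicit Types (f : 'rV[R]_d -> R) (r : space R d -> R) (k : 'I_d -> nat).

Lemma Rint_torus_cst (c : R) : \int[mu]_x c = c / rho_inf L d.
Proof.
rewrite Rint_cst// /rho_inf invrK.
have E := torus_measureT L d; rewrite -[RHS]/(c * fine (l ^+ d)%:E) -E.
by [].
Qed.

(** Expand the integral of the square of r minus its orthogonal projection.
    Modes that vanish identically contribute nothing; hence
    the inequality in [trig_mode_sqnorm_le]. *)
Lemma bessel N r : bounded_mfun r ->
  \sum_(k : {ffun 'I_d -> 'I_N}) mode_weight L (fun i => k i) *
    \sum_(b : {ffun 'I_d -> bool}) (\int[mu]_x (trig_mode L b (fun i => k i) x * r x)) ^+ 2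
  <= \int[mu]_x (r x ^+ 2).
Proof.
move=> br.
pose A := ({ffun 'I_d -> 'I_N} * {ffun 'I_d -> bool})%type.
pose n (q : A) := mode_weight L (fun i => q.1 i).
pose T (q : A) x := trig_mode L q.2 (fun i => q.1 i) x.
pose c (q : A) := \int[mu]_x (T q x * r x).
have bT q : bounded_mfun (T q) by exact: bounded_mfun_trig_mode.
have bTr q : bounded_mfun (fun x => T q x * r x) by exact: bounded_mfunM.
rewrite (_ : \sum_k _ = \sum_q n q * c q ^+ 2); last first.
  under eq_bigr do rewrite mulr_sumr.
  by rewrite pair_big_dep/=.
have ortho q q' : \int[mu]_x (T q x * T q' x) =
  (q == q')%:R * trig_mode_sqnorm L q.2 (fun i => q.1 i).
  rewrite /T Rint_trig_modeM; congr (_%:R * _); congr nat_of_bool.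
  apply/andP/eqP => [[/forallP h1 /forallP h2]|->]; last first.
    by split; apply/forallP.
  case: q q' h1 h2 => q1 q2 [q1' q2'] /= h1 h2; congr pair; apply/ffunP => i.
    exact/val_inj/eqP/h2.
  exact/eqP/h1.
pose S x := \sum_q n q * c q * T q x.
have bS : bounded_mfun S by apply: bounded_mfun_sum => q; exact: bounded_mfunZ.
have rS : \int[mu]_x (S x * r x) = \sum_q n q * c q ^+ 2.
  transitivity (\int[mu]_x (\sum_q n q * c q * (T q x * r x))).
    by apply: eq_Rintegral => x _; rewrite mulr_suml; apply: eq_bigr => q _; rewrite mulrA.
  rewrite Rint_sum//; last by move=> q; exact: bounded_mfunZ.
  by apply: eq_bigr => q _; rewrite RintZ// -/(c q) expr2 mulrA.
have TS q : \int[mu]_x (T q x * S x) = n q * c q * trig_mode_sqnorm L q.2 (fun i => q.1 i).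
  have bTT q' : bounded_mfun (fun x => T q x * T q' x) by exact: bounded_mfunM.
  transitivity (\int[mu]_x (\sum_q' n q' * c q' * (T q x * T q' x))).
    by apply: eq_Rintegral => x _; rewrite mulr_sumr; apply: eq_bigr => q' _; ring.
  rewrite Rint_sum//; last by move=> q'; exact: bounded_mfunZ.
  rewrite (bigD1 q)//= RintZ// ortho eqxx mul1r big1 ?addr0// => q' qq'.
  by rewrite RintZ// ortho eq_sym (negbTE qq') mul0r mulr0.
have SS : \int[mu]_x (S x * S x) <= \sum_q n q * c q ^+ 2.
  have bTS q : bounded_mfun (fun x => T q x * S x) by exact: bounded_mfunM.
  rewrite [leLHS](_ : _ = \int[mu]_x (\sum_q n q * c q * (T q x * S x))); last first.
    by apply: eq_Rintegral => x _; rewrite mulr_suml; apply: eq_bigr => q _; ring.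
  rewrite Rint_sum//; last by move=> q; exact: bounded_mfunZ.
  apply: ler_sum => q _; rewrite RintZ// TS.
  have n0 : 0 < n q := mode_weight_gt0 L _.
  rewrite (_ : _ * _ = (n q * c q ^+ 2) * (n q * trig_mode_sqnorm L q.2 (fun i => q.1 i)));
    last by ring.
  by rewrite ler_piMr ?trig_mode_sqnorm_le// mulr_ge0 ?sqr_ge0// ltW.
have : 0 <= \int[mu]_x ((r x - S x) ^+ 2) by apply: Rintegral_ge0 => x _; exact: sqr_ge0.
have brr : bounded_mfun (fun x => r x ^+ 2) by exact: bounded_mfunX.
have bSr : bounded_mfun (fun x => S x * r x) by exact: bounded_mfunM.
have bSS : bounded_mfun (fun x => S x * S x) by exact: bounded_mfunM.
rewrite [leRHS](_ : _ = \int[mu]_x (r x ^+ 2) - 2 * (\int[mu]_x (S x * r x)) + \int[mu]_x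
  (S x * S x)).
  by rewrite rS; lra.
transitivity (\int[mu]_x ((r x ^+ 2 - 2 * (S x * r x)) + S x * S x)).
  by apply: eq_Rintegral => x _; ring.
by rewrite RintD ?RintB ?RintZ//;
  [exact: bounded_mfunZ|apply: bounded_mfunB => //; exact: bounded_mfunZ].
Qed.

Lemma Rint_trig_mode1 b k : \int[mu]_x trig_mode L b k x =
  ([forall i, ~~ b i] && [forall i, k i == 0%N])%:R / rho_inf L d.
Proof.
have -> : \int[mu]_x trig_mode L b k x =
  \int[mu]_x (trig_mode L b k x * trig_mode L (fun=> false) (fun=> 0%N) x).
  apply: eq_Rintegral => x _; rewrite [X in _ * X]/trig_mode big1 ?mulr1// => i _.
  by rewrite /trig mul0r cos0.
rewrite Rint_trig_modeM.
have -> : [forall i, b i == false] = [forall i, ~~ b i].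
  by apply: eq_forallb => i; rewrite eqbF_neg.
case: andP => [[/forallP hb /forallP hk]|_]; last by rewrite !mul0r.
rewrite !mul1r /rho_inf invrK -/l /trig_mode_sqnorm (eq_bigr (fun=> l)).
  by rewrite prodr_const card_ord.
by move=> i _; rewrite /trig_sqnorm (hk i) (negbTE (hb i)) mul1r.
Qed.

Lemma trig_mode_le1 b k x : `|trig_mode L b k x| <= 1.
Proof.
rewrite /trig_mode normr_prod; apply: (@le_trans _ _ (\prod_(i < d) (1 : R))); last by rewrite big1.
apply: ler_prod => i _; rewrite normr_ge0/= /trig.
by case: (b i); rewrite ler_norml ?sin_geN1 ?sin_le1 ?cos_geN1 ?cos_le1.
Qed.

Section approximable.
Context f (fa : trig_approximable L f).

Lemma bounded_mfun_vec : bounded_mfun (fun x : space R d => f (vec x)).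
Proof.
apply: bounded_mfun_approx => e e0; have [N [a fp]] := fa e0.
by exists (fun x => trig_poly L a (vec x)) => //; exact: bounded_mfun_trig_poly.
Qed.

Lemma bounded_mfun_vecB : bounded_mfun (fun z : space R d * space R d => f (vec z.1 - vec z.2)).
Proof.
apply: bounded_mfun_approx => e e0; have [N [a fp]] := fa e0.
by exists (fun z => trig_poly L a (vec z.1 - vec z.2)) => //; exact: bounded_mfun_trig_polyB.
Qed.

Lemma cosine_coef_close N (a : {ffun 'I_d -> 'I_N} -> R) (e : R) k :
  (forall x, `|f x - trig_poly L a x| <= e) ->
  `|cosine_coef L f k - cosine_coef L (trig_poly L a) k| <= e / rho_inf L d.
Proof.
move=> fp; have bt := bounded_mfun_trig_mode L (fun=> false) k.
have bp := bounded_mfun_trig_poly L a; have bf := bounded_mfun_vec.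
rewrite /cosine_coef -RintB//; [|exact: bounded_mfunM|exact: bounded_mfunM].
rewrite (le_trans (Rint_norm_le _ _))//; first by apply: bounded_mfunB; exact: bounded_mfunM.
rewrite (_ : e / rho_inf L d = \int[mu]_x e); last first.
  by rewrite Rint_torus_cst.
apply: le_Rint => //; first by apply: bounded_mfun_norm; apply: bounded_mfunB; exact: bounded_mfunM.
  exact: bounded_mfun_cst.
move=> x; rewrite -mulrBl normrM -[leRHS]mulr1 ler_pM ?normr_ge0//; exact: trig_mode_le1.
Qed.

Lemma interaction_form_close N (a : {ffun 'I_d -> 'I_N} -> R) (e : R) r : bounded_mfun r ->
  (forall x, `|f x - trig_poly L a x| <= e) ->
  `|interaction_form L f r - interaction_form L (trig_poly L a) r| <= e * (\int[mu]_x `|r x|) ^+ 2.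
Proof.
move=> br fp; have bp := bounded_mfun_trig_polyB L a; have bf := bounded_mfun_vecB.
have br1 : bounded_mfun (fun z : space R d * space R d => r z.1) :=
  bounded_mfun_comp measurable_fst br.
have br2 : bounded_mfun (fun z : space R d * space R d => r z.2) :=
  bounded_mfun_comp measurable_snd br.
have bn := bounded_mfun_norm br.
have bF1 : bounded_mfun (fun z : space R d * space R d => f (vec z.1 - vec z.2) * r z.1 * r z.2).
  by apply: bounded_mfunM => //; exact: bounded_mfunM.
have bF2 : bounded_mfun (fun z : space R d * space R d =>
  trig_poly L a (vec z.1 - vec z.2) * r z.1 * r z.2).
  by apply: bounded_mfunM => //; exact: bounded_mfunM.
rewrite /interaction_form -RintB// (le_trans (Rint_norm_le _ _))//; first exact: bounded_mfunB.
have bnn : bounded_mfun (fun z : space R d * space R d => `|r z.1| * `|r z.2|).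
  by apply: bounded_mfunM; exact: bounded_mfun_norm.
rewrite expr2 -(Rint_product mu mu bn bn) -RintZ//.
apply: le_Rint => //; [by apply: bounded_mfun_norm; exact: bounded_mfunB|exact: bounded_mfunZ|].
move=> z; rewrite -!mulrBl !normrM -mulrA ler_wpM2r//.
Qed.

End approximable.
(** For a trigonometric polynomial only the frequencies 0 and k0 survive in the
    diagonal form of the energy; the cross term is absent because they differ.
    The general case follows by uniform approximation. *)
Lemma interaction_form_single_mode f k0 (s : R) : trig_approximable L f ->
  (exists i, k0 i != 0%N) ->
  interaction_form L f (fun x => rho_inf L d + s * trig_mode L (fun=> false) k0 x) =
  rho_inf L d * cosine_coef L f (fun=> 0%N) + s ^+ 2 / mode_weight L k0 * cosine_coef L f k0.
Proof.
move=> fa [i0 k0i0].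
set r := (fun x => _).
have br : bounded_mfun r by apply: bounded_mfunD;
  [exact: bounded_mfun_cst|apply: bounded_mfunZ; exact: bounded_mfun_trig_mode].
have rho0 : 0 < rho_inf L d by rewrite /rho_inf invr_gt0 exprn_gt0.
have n0 : 0 < mode_weight L k0 := mode_weight_gt0 L k0.
have poly N (a : {ffun 'I_d -> 'I_N} -> R) : interaction_form L (trig_poly L a) r =
    rho_inf L d * cosine_coef L (trig_poly L a) (fun=> 0%N) +
    s ^+ 2 / mode_weight L k0 * cosine_coef L (trig_poly L a) k0.
  rewrite interaction_form_trig_poly// !cosine_coef_trig_poly !mulr_sumr -big_split/=.
  apply: eq_bigr => k _.
  have bt b k1 : bounded_mfun
    (fun x : space R d => trig_mode L b k1 x * trig_mode L (fun=> false) k0 x).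
    by apply: bounded_mfunM; exact: bounded_mfun_trig_mode.
  have E b : \int[mu]_x (trig_mode L b (fun i => k i) x * r x) =
     [forall i, ~~ b i]%:R * ((same_freq (fun i => k i) (fun=> 0%N))%:R
       + s * ((same_freq (fun i => k i) k0)%:R / mode_weight L k0)).
    transitivity (\int[mu]_x (rho_inf L d * trig_mode L b (fun i => k i) x
       + s * (trig_mode L b (fun i => k i) x * trig_mode L (fun=> false) k0 x))).
      by apply: eq_Rintegral => x _; rewrite /r; ring.
    rewrite RintD//; [|by apply: bounded_mfunZ; exact: bounded_mfun_trig_mode|exact: bounded_mfunZ].
    rewrite !RintZ//; last exact: bounded_mfun_trig_mode.
    rewrite Rint_trig_mode1 Rint_trig_modeM.
    have -> : [forall i, b i == false] = [forall i, ~~ b i].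
      by apply: eq_forallb => i; rewrite eqbF_neg.
    rewrite /same_freq -!mulnb !natrM mulrDr; congr (_ + _).
      by field; rewrite gt_eqF.
    case: forallP => [hb|_]; last by rewrite !(mul0r, mulr0).
    case: forallP => [hk|_]; last by rewrite !(mul0r, mulr0).
    rewrite !mul1r; congr (_ * _); rewrite -trig_mode_sqnorm_cos.
    apply: eq_bigr => i _; congr trig_sqnorm; [exact/negbTE|exact/eqP].
  under eq_bigr do rewrite E.
  pose b0 : {ffun 'I_d -> bool} := [ffun=> false].
  rewrite (bigD1 b0)//= (_ : [forall i, ~~ b0 i] = true); last first.
    by apply/forallP => i; rewrite ffunE.
  rewrite big1 ?addr0 => [|b bb0]; last first.
    case: forallP => [hb|_]; last by rewrite mul0r expr0n.
    suff E' : b = b0 by rewrite E' eqxx in bb0.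
    by apply/ffunP => i; rewrite ffunE; exact/negbTE.
  have -> : (mode_weight L (d:=d) (fun=> 0%N)) = rho_inf L d.
    rewrite /mode_weight /rho_inf (eq_bigr (fun=> l^-1)).
      by rewrite prodr_const card_ord -exprVn.
    by move=> i _; rewrite eqxx /= (_ : 2 - 1 = 1) ?mul1r//; ring.
  have : (same_freq (fun i => k i) (fun=> 0%N)) && (same_freq (fun i => k i) k0) = false.
    apply/negP => /andP[/forallP h1 /forallP h2].
    by move: k0i0; rewrite -(eqP (h2 i0)) (eqP (h1 i0)).
  case: (same_freq _ (fun=> 0%N)); case: (same_freq _ k0) => //= _; field;
    by rewrite ?gt_eqF.
apply: (@eq_eps_mul _ _ _ ((\int[mu]_x `|r x|) ^+ 2 + rho_inf L d / rho_inf L d +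
   s ^+ 2 / mode_weight L k0 / rho_inf L d)).
  by rewrite !addr_ge0 ?sqr_ge0 ?divr_ge0 ?sqr_ge0// ltW.
move=> e e0; have [N [a fp]] := fa e e0.
have h1 := interaction_form_close fa br fp.
have h2 := cosine_coef_close fa (fun=> 0%N) fp.
have h3 := cosine_coef_close fa k0 fp.
rewrite poly in h1.
set F := interaction_form L f r in h1 *; set g0 := cosine_coef L f _ in h2 *; set g1 :=
  cosine_coef L f k0 in h3 *.
set p0 := cosine_coef L (trig_poly L a) _ in h1 h2; set p1 :=
  cosine_coef L (trig_poly L a) k0 in h1 h3.
set J := _ ^+ 2 in h1 *; set q := s ^+ 2 / _ in h1 *.
have q0 : 0 <= q by rewrite divr_ge0 ?sqr_ge0// ltW.
rewrite (_ : F - _ = (F - (rho_inf L d * p0 + q * p1)) - rho_inf L d * (g0 - p0) - q *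
  (g1 - p1)); last by ring.
rewrite (le_trans (ler_normB _ _))// [leRHS]mulrDr lerD//; last first.
  rewrite normrM (ger0_norm q0) (_ : e * (q / _) = q * (e / rho_inf L d)); last by ring.
  exact: ler_wpM2l.
rewrite (le_trans (ler_normB _ _))// [leRHS]mulrDr lerD//.
rewrite normrM (gtr0_norm rho0) (_ : e * (_ / _) = rho_inf L d * (e / rho_inf L d)); last by ring.
by rewrite ler_wpM2l// ltW.
Qed.
(** The Fourier coefficients of a trigonometric polynomial close to f are at
    least - v up to a small error, and the diagonal form of the energy is then
    controlled by Bessel's inequality applied to r - rho; the frequency 0 is
    treated apart, since there r and r - rho have different coefficients. *)
Lemma interaction_form_lower_bound f r (v : R) : trig_approximable L f ->
  cosine_coef L f (fun=> 0%N) = 0 -> 0 <= v ->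
  (forall k, (exists i, k i != 0%N) -> - v <= cosine_coef L f k) ->
  bounded_mfun r -> \int[mu]_x r x = 1 ->
  - v * \int[mu]_x ((r x - rho_inf L d) ^+ 2) <= interaction_form L f r.
Proof.
move=> fa f0 v0 fv br r1.
have rho0 : 0 < rho_inf L d by rewrite /rho_inf invr_gt0 exprn_gt0.
set D := \int[mu]_x _.
have be : bounded_mfun (fun x => r x - rho_inf L d) by apply: bounded_mfunB => //;
  exact: bounded_mfun_cst.
have D0 : 0 <= D by apply: Rintegral_ge0 => x _; exact: sqr_ge0.
apply: (@le_eps_mul _ _ _ ((\int[mu]_x `|r x|) ^+ 2 + 1 + D / rho_inf L d)).
  by rewrite !addr_ge0 ?sqr_ge0 ?divr_ge0 ?sqr_ge0// ltW.
move=> e e0; have [N [a fp]] := fa e e0.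
have h1 := interaction_form_close fa br fp.
suff : - v * D - e - e * (D / rho_inf L d) <= interaction_form L (trig_poly L a) r.
  by move: h1; rewrite ler_norml => /andP[h1 _]; lra.
(* the lower bound - v degrades to - w for the polynomial *)
pose w := v + e / rho_inf L d.
have w0 : 0 <= w by rewrite addr_ge0// divr_ge0// ltW.
rewrite (_ : _ - _ - _ = - w * D - e); last by rewrite /w; ring.
rewrite interaction_form_trig_poly//.
have B := bessel N be.
rewrite -/D in B.
have : - w * D <= - w * (\sum_(k : {ffun 'I_d -> 'I_N}) mode_weight L (fun i => k i) *
    \sum_(b : {ffun 'I_d -> bool})
      (\int[mu]_x (trig_mode L b (fun i => k i) x * (r x - rho_inf L d))) ^+ 2).
  by rewrite !mulNr lerN2 ler_wpM2l.
move=> H; apply: (le_trans (lerB H (lexx e))); move=> {H}.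
have Er b k : \int[mu]_x (trig_mode L b k x * (r x - rho_inf L d)) =
    \int[mu]_x (trig_mode L b k x * r x) - ([forall i, ~~ b i] && [forall i, k i == 0%N])%:R.
  have bt := bounded_mfun_trig_mode L b k.
  transitivity (\int[mu]_x (trig_mode L b k x * r x - rho_inf L d * trig_mode L b k x)).
    by apply: eq_Rintegral => x _; ring.
  rewrite RintB ?RintZ//; [|exact: bounded_mfunM|exact: bounded_mfunZ].
  by rewrite Rint_trig_mode1; congr (_ - _); field; rewrite gt_eqF.
have nz k (b : {ffun 'I_d -> bool}) : (exists i, k i != 0%N) ->
   \int[mu]_x (trig_mode L b k x * (r x - rho_inf L d)) = \int[mu]_x (trig_mode L b k x * r x).
  move=> [i ki]; rewrite Er; case: (forallP (P := fun i => k i == 0%N)) => [h|_].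
    by rewrite h in ki.
  by rewrite andbF subr0.
have zero (k : 'I_d -> nat) : (forall i, k i = 0%N) ->
    \sum_(b : {ffun 'I_d -> bool}) (\int[mu]_x (trig_mode L b k x * r x)) ^+ 2 = 1.
  move=> hk; pose b0 : {ffun 'I_d -> bool} := [ffun=> false].
  rewrite (bigD1 b0)//= big1 ?addr0 => [|b bb0].
    rewrite (_ : \int[mu]_x _ = 1) ?expr1n// -[RHS]r1; apply: eq_Rintegral => x _.
    by rewrite /trig_mode big1 ?mul1r// => i _; rewrite /trig ffunE hk mul0r cos0.
  have [i bi] : exists i, b i.
    apply/existsP; rewrite -[X in is_true X]negbK negb_exists; apply/negP => /forallP h.
    by case/eqP : bb0; apply/ffunP => i; rewrite ffunE; exact/negbTE/h.
  rewrite (_ : \int[mu]_x _ = 0) ?expr0n//.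
  rewrite (_ : 0 = \int[mu]_x (0 : R)); last by rewrite Rint_cst ?mul0r.
  apply: eq_Rintegral => x _.
  by rewrite /trig_mode (bigD1 i)//= /trig bi hk mul0r sin0 !mul0r.
have nrm0 (k : 'I_d -> nat) : (forall i, k i = 0%N) -> mode_weight L k = rho_inf L d.
  move=> hk; rewrite /mode_weight /rho_inf (eq_bigr (fun=> l^-1)).
    by rewrite prodr_const card_ord -exprVn.
  by move=> i _; rewrite hk eqxx /= (_ : 2 - 1 = 1) ?mul1r//; ring.
pose Sr (k : {ffun 'I_d -> 'I_N}) := \sum_(b : {ffun 'I_d -> bool})
    (\int[mu]_x (trig_mode L b (fun i => k i) x * r x)) ^+ 2.
pose Se (k : {ffun 'I_d -> 'I_N}) := \sum_(b : {ffun 'I_d -> bool})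
    (\int[mu]_x (trig_mode L b (fun i => k i) x * (r x - rho_inf L d))) ^+ 2.
have Se0 (k : {ffun 'I_d -> 'I_N}) : 0 <= Se k by apply: sumr_ge0 => b _; exact: sqr_ge0.
have n0 (k : {ffun 'I_d -> 'I_N}) : 0 < mode_weight L (fun i => k i) := mode_weight_gt0 L _.
have term1 (k : {ffun 'I_d -> 'I_N}) : (exists i, k i != 0%N :> nat) ->
    - w * (mode_weight L (fun i => k i) * Se k) <= a k * Sr k.
  move=> ki; have -> : Sr k = Se k by apply: eq_bigr => b _; rewrite nz.
  rewrite (trig_poly_coef L a k) mulrA ler_wpM2r// mulrC ler_pM2l//.
  have := cosine_coef_close fa (fun i => k i) fp; have := fv (fun i => k i) ki.
  by rewrite ler_norml /w => h2 /andP[h3 h4]; lra.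
have term0 (k : {ffun 'I_d -> 'I_N}) : (forall i, k i = 0%N :> nat) ->
    - w * (mode_weight L (fun i => k i) * Se k) - e <= a k * Sr k.
  move=> ki; rewrite /Sr (zero (fun i => k i))// mulr1.
  apply: (@le_trans _ _ (- e)).
    by rewrite gerDr mulNr oppr_le0 mulr_ge0// mulr_ge0// ltW.
  rewrite (trig_poly_coef L a k) (nrm0 (fun i => k i))//.
  have := cosine_coef_close fa (fun i => k i) fp.
  rewrite (_ : (fun i => k i : nat) = (fun=> 0%N)); last exact/funext.
  rewrite f0 sub0r normrN ler_norml => /andP[h3 _].
  rewrite mulrC -ler_pdivrMr// mulNr; exact: h3.
rewrite mulr_sumr.
have [k0 hk0|nok] := pickP (fun k : {ffun 'I_d -> 'I_N} => [forall i, k i == 0%N :> nat]).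
  have {}hk0 : forall i, k0 i = 0%N :> nat by move=> i; exact/eqP/(forallP hk0).
  rewrite (bigD1 k0)//= [leRHS](bigD1 k0)//= addrAC lerD//; first exact: term0.
  apply: ler_sum => k kk0; apply: term1.
  apply/existsP; rewrite -[X in is_true X]negbK negb_exists; apply/negP => /forallP h.
  case/eqP : kk0; apply/ffunP => i; apply/val_inj => /=.
  by rewrite hk0; apply/eqP/negPn/h.
rewrite lerBlDr (le_trans (_ : _ <= \sum_k a k * Sr k))//; last by rewrite lerDl ltW.
apply: ler_sum => k _; apply: term1.
by have /forallPn := negbT (nok k).
Qed.

End interaction_form_estimates.

(** * Free energy of states with bounded density *)

Section measure_with_density.
Context {dd : measure_display} {T : measurableType dd} {R : realType}.
Variables (mu : {measure set T -> \bar R}) (r : T -> R).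
Hypotheses (mr : measurable_fun setT r) (r0 : forall x, 0 <= r x)
  (r1 : (\int[mu]_x (r x)%:E = 1)%E).
(** The proofs are arguments of the measure so that its probability structure is
    canonical. *)
Definition density_measure (_ : measurable_fun setT r) (_ : forall x, 0 <= r x)
    (_ : (\int[mu]_x (r x)%:E = 1)%E) : set T -> \bar R :=
  fun A => (\int[mu]_(x in A) (r x)%:E)%E.

Local Notation nu := (density_measure mr r0 r1).

Let nu0 : nu set0 = 0%E. Proof. by rewrite /nu integral_set0. Qed.

Let nu_ge0 A : (0 <= nu A)%E.
Proof. by apply: integral_ge0 => x _; rewrite lee_fin. Qed.

Let nu_additive : semi_sigma_additive nu.
Proof.
apply: semi_sigma_additive_nng_induced; first exact/measurable_EFinP.
by move=> x; rewrite lee_fin.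
Qed.

HB.instance Definition _ := isMeasure.Build _ _ _ nu nu0 nu_ge0 nu_additive.

HB.instance Definition _ := Measure_isProbability.Build _ _ _ nu r1.

Lemma exists_probability_density :
  exists P : probability T R, forall A, P A = (\int[mu]_(x in A) (r x)%:E)%E.
Proof. by exists nu. Qed.

End measure_with_density.

Section states.
Context {R : realType} (L : {posnum R}) (d : nat).
Let mu := torus_measure L d.
Let mufin : (mu setT < +oo)%E. Proof. exact: torus_lty. Qed.
Let mu2fin : ((mu \x mu)%E setT < +oo)%E. Proof. exact: product_measure_lty. Qed.
Implicit Types (P : probability (space R d) R) (r : space R d -> R).

(** Equality almost everywhere with an everywhere bounded r gives access to the
    integral calculus above, while Radon-Nikodym derivatives are determined only up to
    null sets. *)
Definition has_density P r :=
  P `<< mu /\ ae_eq mu setT (density L P) r.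

Let RN_integral P A : P `<< mu -> measurable A ->
  P A = (\int[mu]_(x in A) Radon_Nikodym (charge_of_finite_measure P) mu x)%E.
Proof. exact: (@Radon_Nikodym_integral _ _ _ (charge_of_finite_measure P) mu A). Qed.

Lemma has_densityP P r : bounded_mfun r ->
  (forall A, measurable A -> P A = (\int[mu]_(x in A) (r x)%:E)%E) -> has_density P r.
Proof.
move=> br PA.
have mEr : measurable_fun setT (EFin \o r) by apply/measurable_EFinP; case: br.
have dom : P `<< mu.
  apply/null_content_dominatesP => A mA A0; rewrite PA//.
  by apply: null_set_integral => //; exact: measurable_funTS.
split=> //.
have : ae_eq mu setT (Radon_Nikodym (charge_of_finite_measure P) mu) (EFin \o r).
  apply: integral_ae_eq => //; first exact: Radon_Nikodym_integrable.
  by move=> E _ mE; rewrite -PA// -RN_integral.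
by apply: filterS => x /(_ I) /= h _; rewrite /density h.
Qed.

Lemma measurable_density P : P `<< mu -> measurable_fun setT (density L P).
Proof.
move=> dom; rewrite /density; exact: measurableT_comp.
Qed.

Lemma density_integral P r A : has_density P r -> bounded_mfun r -> measurable A ->
  P A = (\int[mu]_(x in A) (r x)%:E)%E.
Proof.
move=> [dom Pr] [mr _] mA.
rewrite RN_integral//.
apply: ae_eq_integral => //.
- apply: measurable_funTS; apply: (measurable_int mu); exact: Radon_Nikodym_integrable.
- by apply: measurable_funTS; exact/measurable_EFinP.
- apply: filterS Pr => x /(_ I) h _; rewrite -h /density fineK//.
  exact: Radon_Nikodym_fin_num.
Qed.

Lemma has_density_mass P r : has_density P r -> bounded_mfun r -> \int[mu]_x r x = 1.
Proof.
move=> Pr br; rewrite /Rintegral -(density_integral Pr br)//.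
by rewrite probability_setT.
Qed.

Lemma has_density_uniform : has_density (uniform_state L d) (fun=> rho_inf L d).
Proof.
apply: has_densityP; first exact: bounded_mfun_cst.
move=> A mA; rewrite integral_cst//.
Qed.

Lemma same_density_same_state P Q r : bounded_mfun r -> has_density P r -> has_density Q r ->
  same_state P Q.
Proof.
by move=> br hP hQ A mA; rewrite (density_integral hP)// (density_integral hQ).
Qed.

Lemma bounded_mfun_powR (m : R) r : 0 <= m -> bounded_mfun r -> (forall x, 0 <= r x) ->
  bounded_mfun (fun x => r x `^ m).
Proof.
move=> m0 [mr [M rM]] r0; split.
  exact: (measurableT_comp (measurable_powR m) mr).
exists (M `^ m) => x; rewrite ger0_norm ?powR_ge0//.
have rx : r x <= M by rewrite -[r x]ger0_norm.
by apply: ge0_ler_powR; rewrite ?nnegrE// (le_trans (r0 x)).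
Qed.

(** The interaction integral is taken over the product space, where the
    exceptional set of the density is covered by two null cylinders. *)
Lemma free_energy_density m W beta P r : 1 < m -> trig_approximable L W ->
  bounded_mfun r -> (forall x, 0 <= r x) -> has_density P r ->
  free_energy L m W beta P =
  (beta^-1 / (m - 1) * (\int[mu]_x (r x `^ m)) - beta^-1 / (m - 1)
   + 2^-1 * interaction_form L W r)%:E.
Proof.
move=> m1 Wa br r0 [dom Pr].
have bp : bounded_mfun (fun x => r x `^ m) by apply: bounded_mfun_powR => //; lra.
have mD := measurable_density dom.
have pow : power_integral L m P = (\int[mu]_x (r x `^ m))%:E.
  rewrite /power_integral -(bounded_mfun_fineK mufin bp).
  apply: ae_eq_integral => //.
  - apply/measurable_EFinP; exact: (measurableT_comp (measurable_powR m) mD).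
  - by apply/measurable_EFinP; case: bp.
  - by apply: filterS Pr => x /(_ I) ->.
have bW := bounded_mfun_vecB Wa.
have br1 : bounded_mfun (fun z : space R d * space R d => r z.1) :=
  bounded_mfun_comp measurable_fst br.
have br2 : bounded_mfun (fun z : space R d * space R d => r z.2) :=
  bounded_mfun_comp measurable_snd br.
have bF : bounded_mfun (fun z : space R d * space R d => W (vec z.1 - vec z.2) * r z.1 * r z.2).
  by apply: bounded_mfunM => //; exact: bounded_mfunM.
have int : interaction L W P = (interaction_form L W r)%:E.
  rewrite /interaction /interaction_form -(bounded_mfun_fineK mu2fin bF).
  apply: ae_eq_integral => //.
  - apply/measurable_EFinP; apply: measurable_funM; last first.
      exact: (measurableT_comp mD measurable_snd).
    apply: measurable_funM; first by case: bW.
    exact: (measurableT_comp mD measurable_fst).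
  - by apply/measurable_EFinP; case: bF.
  - have [N [mN N0 HN]] := Pr.
    have mX : measurable (N `*` [set: space R d]) by exact: measurableX.
    have mY : measurable ([set: space R d] `*` N) by exact: measurableX.
    exists (N `*` setT `|` setT `*` N); split.
    + exact: measurableU.
    + apply/eqP; rewrite -measure_le0.
      rewrite (le_trans (measureU2 _ _ _))//.
      by rewrite [X in (X + _)%E]product_measure1E// [X in (_ + X)%E]product_measure1E// !N0
        mul0e mule0 adde0.
    + move=> [x y] /= H.
      have [xN|xN] := pselect (N x); first by left.
      have [yN|yN] := pselect (N y); first by right.
      exfalso; apply: H => _.
      have ex : density L P x = r x by apply: contrapT => h; apply/xN/HN => /= /(_ I).
      have ey : density L P y = r y by apply: contrapT => h; apply/yN/HN => /= /(_ I).
      by rewrite ex ey.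
rewrite /free_energy asboolT; last by split => //; rewrite ?pow ?int.
by rewrite pow int -!EFinM -EFinB -EFinD.
Qed.

Lemma free_energy_fin m W beta P : free_energy L m W beta P != +oo%E -> P `<< mu.
Proof. by rewrite /free_energy; case: asboolP => [[]//|_]; rewrite eqxx. Qed.

End states.

(** * Stability of the uniform state at the transition *)

Section transition.
Context {R : realType} (L : {posnum R}) (d : nat) (m : R) (W : 'rV[R]_d -> R).
Hypotheses (hm : 1 < m) (Wa : trig_approximable L W)
  (W0 : cosine_coef L W (fun=> 0%N) = 0).
Let mu := torus_measure L d.
Let mufin : (mu setT < +oo)%E. Proof. exact: torus_lty. Qed.
Let rho : R := rho_inf L d.
Let rho0 : 0 < rho. Proof. by rewrite /rho /rho_inf invr_gt0 exprn_gt0. Qed.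
Let m10 : 0 < m - 1. Proof. by rewrite subr_gt0. Qed.

(** A Riemann-Lebesgue lemma: the coefficients of an approximating polynomial
    vanish outside a box. *)
Lemma cosine_coef_small_off_box (e : R) : 0 < e -> exists N, forall k,
  (exists i, (N <= k i)%N) -> `|cosine_coef L W k| <= e.
Proof.
move=> e0; have er0 : 0 < e * rho by rewrite mulr_gt0.
have [N [a fp]] := Wa er0; exists N => k [i Nk].
have := cosine_coef_close Wa k fp; rewrite cosine_coef_trig_poly big1 ?subr0; last first.
  move=> j _; rewrite /same_freq (_ : [forall i, _] = false) ?mul0r ?mulr0//.
  apply/negP => /forallP /(_ i) /eqP ji.
  by move: Nk; rewrite -ji leqNgt ltn_ord.
by rewrite -/rho mulfK// gt_eqF.
Qed.

Lemma interaction_form_uniform : (0 < d)%N -> interaction_form L W (fun=> rho) = 0.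
Proof.
move=> d0; have h := @interaction_form_single_mode R L d W (fun=> 1%N) 0 Wa.
have {h} := h (ex_intro _ (Ordinal d0) isT).
rewrite W0 mulr0 expr0n mul0r mul0r addr0 => <-.
by congr interaction_form; apply/funext => x; rewrite mul0r addr0.
Qed.

Lemma measurable_torus_dom : measurable (torus_dom L d).
Proof.
rewrite (_ : torus_dom L d = \bigcap_(i in [set: 'I_d]) (@tnth _ _ ^~ i @^-1` circle_dom L)).
  apply: fin_bigcap_measurable => // i _.
  by rewrite -[X in measurable X]setTI; apply: measurable_tnth => //; exact: measurable_circle_dom.
apply/seteqP; split => x h i; have := h i.
  by rewrite /circle_dom /= in_itv.
by move=> /(_ I); rewrite /circle_dom /= in_itv.
Qed.

(** That the uniform state lives on the torus says that the complement of the
    fundamental domain is a null set. *)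
Lemma dominated_on_torus (Q : probability (space R d) R) :
  on_torus L (uniform_state L d) -> Q `<< mu -> on_torus L Q.
Proof.
rewrite /on_torus => Ud /null_content_dominatesP Qmu.
have mdom := measurable_torus_dom.
have mdomC := measurableC mdom.
have : uniform_state L d (~` torus_dom L d) = 0%E by rewrite probability_setC// Ud subee.
rewrite /uniform_state /mscale/= => /eqP; rewrite mule_eq0 eqe gt_eqF//= => /eqP mu0.
have := Qmu _ mdomC mu0; rewrite probability_setC//.
rewrite -(fineK (fin_num_measure Q _ mdom)) -EFinB => -[h]; congr (_%:E); lra.
Qed.

Let unif_energy beta : (0 < d)%N ->
  free_energy L m W beta (uniform_state L d) =
  (beta^-1 / (m - 1) * (\int[mu]_x (rho `^ m)) - beta^-1 / (m - 1))%:E.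
Proof.
move=> d0; rewrite (free_energy_density beta hm Wa (bounded_mfun_cst rho) _
  (has_density_uniform L d)).
  by rewrite interaction_form_uniform// mulr0 addr0.
by move=> _; exact: ltW.
Qed.
(** Second-order necessary condition for minimality, obtained with the competitor
    rho + s cos_k.  The linear term of the expansion of the entropy integrates to
    0, and the two quadratic terms carry the common factor s^2 / N_k^2, by which
    the inequality is divided. *)
Lemma uniform_minimiser_stable beta k : 0 < beta ->
  minimiser L m W beta (uniform_state L d) -> (exists i, k i != 0%N) ->
  - (m * rho `^ (m - 2) / beta) <= cosine_coef L W k.
Proof.
move=> b0 [Ud Umin] kn0; have [i0 _] := kn0.
have d0 : (0 < d)%N by exact: (leq_ltn_trans _ (ltn_ord i0)).
apply/ler_addgt0Pl => e e0.
(* K / (beta (m - 1)) is the entropic part of the second variation plus e *)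
pose K := m * (m - 1) * rho `^ (m - 2) + e * beta * (m - 1).
have KK : m * (m - 1) * rho `^ (m - 2) < K by rewrite ltrDl !mulr_gt0.
have [a /andP[a0 arho] Ha] := powR_le_quadratic rho0 KK.
pose s := a / 2; have s0 : 0 < s by rewrite divr_gt0.
have sa : s < a by rewrite /s; lra.
pose T := trig_mode L (d := d) (fun=> false) k.
have bT : bounded_mfun T := bounded_mfun_trig_mode L _ k.
pose r x := rho + s * T x.
have br : bounded_mfun r by apply: bounded_mfunD; [exact: bounded_mfun_cst|exact: bounded_mfunZ].
have rrho x : `|r x - rho| <= s.
  by rewrite /r addrC addKr normrM gtr0_norm// ler_piMr ?(ltW s0)//; exact: trig_mode_le1.
have rpos x : 0 <= r x.
  by have := rrho x; rewrite ler_norml /s => /andP[h _]; lra.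
have T1 : \int[mu]_x T x = 0.
  rewrite Rint_trig_mode1; case: kn0 => i ki.
  case: (forallP (P := fun i => k i == 0%N)) => [h|_]; last by rewrite andbF mul0r.
  by rewrite h in ki.
have n0 : 0 < mode_weight L k := mode_weight_gt0 L k.
have T2 : \int[mu]_x (T x * T x) = (mode_weight L k)^-1.
  rewrite Rint_trig_modeM trig_mode_sqnorm_cos.
  rewrite (_ : _ && _ = true) ?mul1r//; apply/andP; split; exact/forallP.
have r1 : \int[mu]_x r x = 1.
  rewrite /r RintD//; [|exact: bounded_mfun_cst|exact: bounded_mfunZ].
  by rewrite RintZ// T1 mulr0 addr0 Rint_torus_cst divff// gt_eqF.
have r1E : (\int[mu]_x (r x)%:E = 1)%E by rewrite bounded_mfun_fineK// r1.
have [P PE] := exists_probability_density br.1 rpos r1E.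
have Pr : has_density L P r by apply: has_densityP.
have Pd : on_torus L P by apply: dominated_on_torus => //; exact: Pr.1.
have := Umin P Pd.
rewrite unif_energy// (free_energy_density beta hm Wa br rpos Pr) lee_fin.
rewrite /r (interaction_form_single_mode s Wa kn0) W0 mulr0 add0r -/T.
set g := cosine_coef L W k; set I0 := \int[mu]_x (rho `^ m); set I1 := \int[mu]_x _.
have HI : I1 <= I0 + K / 2 * (s ^+ 2 / mode_weight L k).
  have bm : bounded_mfun (fun x => r x `^ m) by apply: bounded_mfun_powR => //;
    exact: ltW (lt_trans ltr01 hm).
  pose q x := rho `^ m + m * rho `^ (m - 1) * s * T x + K / 2 * s ^+ 2 * (T x * T x).
  have bTT : bounded_mfun (fun x => T x * T x) by exact: bounded_mfunM.
  have bq1 : bounded_mfun (fun x => rho `^ m + m * rho `^ (m - 1) * s * T x).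
    by apply: bounded_mfunD; [exact: bounded_mfun_cst|exact: bounded_mfunZ].
  have -> : I0 + K / 2 * (s ^+ 2 / mode_weight L k) = \int[mu]_x q x.
    rewrite /q RintD//; last exact: bounded_mfunZ.
    rewrite RintD//; [|exact: bounded_mfun_cst|exact: bounded_mfunZ].
    rewrite !RintZ// T1 T2 mulr0 addr0. by congr (_ + _); ring.
  apply: le_Rint => //; first by apply: bounded_mfunD => //; exact: bounded_mfunZ.
  move=> x; have := Ha (r x); rewrite (le_lt_trans (rrho x) sa).
  move=> /(_ isT) /le_trans; apply; rewrite le_eqVlt; apply/orP; left; apply/eqP.
  by rewrite /q /r; ring.
move=> H.
set c := beta^-1 / (m - 1) in H.
have c0 : 0 < c by rewrite divr_gt0 ?invr_gt0.
set z := s ^+ 2 / mode_weight L k in HI H.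
have z0 : 0 < z by rewrite divr_gt0 ?exprn_gt0.
have H2 : 0 <= c * (K / 2 * z) + 2^-1 * (z * g).
  have : c * I1 <= c * (I0 + K / 2 * z) by rewrite ler_wpM2l// ltW.
  by rewrite mulrDr; lra.
have H3 : 0 <= c * K + g.
  rewrite -(pmulr_rge0 _ z0); move: H2; rewrite -(pmulr_rge0 _ (_ : 0 < 2 :> R))//.
  by rewrite (_ : 2 * _ = z * (c * K + g))//; field.
suff : c * K = m * rho `^ (m - 2) / beta + e by move=> E; rewrite E in H3; lra.
by rewrite /c /K; field; rewrite !gt_eqF.
Qed.

(** With a gap, the second variation is bounded below by a positive multiple of
    the squared L^2 norm on a small L^oo ball around the uniform state, for every
    beta slightly above beta_c.  A nontrivial minimiser in this ball would have at
    most the energy of the uniform state, hence be equal to it almost everywhere. *)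
Lemma continuous_no_gap beta_c v : (0 < d)%N ->
  continuous_transition_point L m W beta_c -> 0 <= v -> v < m * rho `^ (m - 2) / beta_c ->
  ~ (forall k, (exists i, k i != 0%N) -> - v <= cosine_coef L W k).
Proof.
move=> d0 [[bc0 _ [Ud _] nonunif] _ cont] v0 vlt Hv.
set t0 := m * _ / _ in vlt.
(* K / (beta_c (m - 1)) is halfway between v and t0; beta < b1 keeps
   K / (beta (m - 1)) above v *)
pose K := (m - 1) * beta_c * ((v + t0) / 2).
have KK : K < m * (m - 1) * rho `^ (m - 2).
  rewrite (_ : m * _ * _ = (m - 1) * beta_c * t0); last first.
    by rewrite /t0; field; rewrite gt_eqF.
  by rewrite ltr_pM2l ?mulr_gt0//; lra.
have [a /andP[a0 arho] Ha] := powR_ge_quadratic rho0 KK.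
pose eta := (t0 - v) / (2 * (v + 1)).
have eta0 : 0 < eta by rewrite divr_gt0//; lra.
have veta : v * eta < (t0 - v) / 2.
  rewrite /eta mulrA ltr_pdivrMr; last by lra.
  by rewrite (_ : _ / 2 * _ = (v + 1) * (t0 - v)); [rewrite ltr_pM2r; lra|field].
pose b1 := beta_c * (1 + eta).
have bcb1 : beta_c < b1 by rewrite /b1 mulrDr mulr1 ltrDl mulr_gt0.
have /choice[fam Hfam] (beta : R) : exists P : probability (space R d) R,
    beta_c < beta -> minimiser L m W beta P /\ ~ same_state P (uniform_state L d).
  have [lt|_] := boolP (beta_c < beta); last by exists (uniform_state L d).
  by have [P P1 P2] := nonunif _ lt; exists P.
have a20 : 0 < a / 2 by rewrite divr_gt0.
have := cont fam (fun beta lt => (Hfam beta lt).1).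
move=> lim0.
have : (limf_esup (fun beta =>
   'N[mu]_+oo[(fun x => (density L (fam beta) x - rho)%:E)])%E beta_c^'+ < (a / 2)%:E)%E.
  by rewrite lim0 lte_fin.
move=> /ereal_inf_lt[_ [V Vbc <-] supV].
have [beta [Vb bb b1b]] : exists beta, [/\ V beta, beta_c < beta & beta < b1].
  near (beta_c^'+) => beta; exists beta; split; near: beta => //.
  - exact: nbhs_right_gt.
  - exact: nbhs_right_lt.
have [[Pd Pmin] Pnon] := Hfam beta bb.
set P := fam beta in Pd Pmin Pnon.
have b0 : 0 < beta by rewrite (lt_trans bc0).
have muT : (0 < mu setT)%E by rewrite torus_measureT lte_fin exprn_gt0.
have nP : ('N[mu]_+oo[(fun x => (density L P x - rho)%:E)] < (a / 2)%:E)%E.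
  by apply: le_lt_trans supV; apply: ereal_sup_ubound; exists beta.
have PU := Pmin _ Ud.
have dom : P `<< mu.
  apply: (@free_energy_fin _ L d m W beta); apply/negP => /eqP Poo.
  by move: PU; rewrite Poo unif_energy// leye_eq.
have mD := measurable_density dom.
have close : \forall x \ae mu, `|density L P x - rho| <= a / 2.
  move/ltW : nP; rewrite unlock /= muT => /ess_supP; apply: filterS => x /=.
  by rewrite lee_fin.
(* clipping gives an everywhere bounded version of the density *)
pose r x := rho + Num.max (- (a / 2)) (Num.min (a / 2) (density L P x - rho)).
have rrho x : `|r x - rho| <= a / 2.
  rewrite /r addrC addKr ler_norml le_max lexx/= ge_max ge_min lexx/=.
  by rewrite andbT; lra.
have br : bounded_mfun r.
  split; last first.
    exists (a / 2 + rho) => x; rewrite -[r x](subrK rho) (le_trans (ler_normD _ _))//.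
    by rewrite lerD// gtr0_norm.
  apply: measurable_funD; first exact: measurable_cst.
  apply: measurable_maxr; first exact: measurable_cst.
  apply: measurable_minr; first exact: measurable_cst.
  by apply: measurable_funB => //; exact: measurable_cst.
have rpos x : 0 <= r x.
  by have := rrho x; rewrite ler_norml => /andP[h _]; lra.
have Pr : has_density L P r.
  split=> //; apply: filterS close => x cx _; rewrite /r.
  move: cx; rewrite ler_norml => /andP[h1 h2].
  by rewrite min_r// max_r// addrC subrK.
have r1 := has_density_mass Pr br.
move: PU; rewrite unif_energy// (free_energy_density beta hm Wa br rpos Pr) lee_fin.
set I0 := \int[mu]_x (rho `^ m); set I1 := \int[mu]_x _ => H.
have := interaction_form_lower_bound Wa W0 v0 Hv br r1.
set D := \int[mu]_x _ => HD.
have be : bounded_mfun (fun x => r x - rho) by apply: bounded_mfunB => //; exact: bounded_mfun_cst.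
have bee : bounded_mfun (fun x => (r x - rho) ^+ 2) by exact: bounded_mfunX.
have e1 : \int[mu]_x (r x - rho) = 0.
  rewrite RintB//; last exact: bounded_mfun_cst.
  by rewrite r1 Rint_torus_cst divff ?subrr// gt_eqF.
have HI : I0 + K / 2 * D <= I1.
  have bm : bounded_mfun (fun x => r x `^ m) by apply: bounded_mfun_powR => //;
    exact: ltW (lt_trans ltr01 hm).
  have bq1 : bounded_mfun (fun x => rho `^ m + m * rho `^ (m - 1) * (r x - rho)).
    by apply: bounded_mfunD; [exact: bounded_mfun_cst|exact: bounded_mfunZ].
  have -> : I0 + K / 2 * D = \int[mu]_x
      (rho `^ m + m * rho `^ (m - 1) * (r x - rho) + K / 2 * (r x - rho) ^+ 2).
    rewrite RintD//; last exact: bounded_mfunZ.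
    rewrite RintD//; [|exact: bounded_mfun_cst|exact: bounded_mfunZ].
    by rewrite !RintZ// e1 mulr0 addr0.
  apply: le_Rint => //; first by apply: bounded_mfunD => //; exact: bounded_mfunZ.
  by move=> x; apply: Ha; rewrite (le_lt_trans (rrho x))//; lra.
have D0 : 0 <= D by apply: Rintegral_ge0 => x _; exact: sqr_ge0.
set c := beta^-1 / (m - 1) in H.
have c0 : 0 < c by rewrite divr_gt0 ?invr_gt0.
have H2 : (c * K - v) * D <= 0.
  have : c * (I0 + K / 2 * D) <= c * I1 by rewrite ler_wpM2l// ltW.
  by rewrite mulrDr; lra.
have cKv : 0 < c * K - v.
  have -> : c * K - v = (beta_c * ((v + t0) / 2) - v * beta) / beta.
    by rewrite /c /K; field; rewrite !gt_eqF.
  rewrite divr_gt0// subr_gt0.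
  apply: (@le_lt_trans _ _ (v * b1)); first by rewrite ler_wpM2l// ltW.
  rewrite /b1 mulrCA ltr_pM2l// mulrDr mulr1; lra.
have D00 : D = 0.
  by apply/eqP; rewrite eq_le D0 andbT; move: H2; rewrite pmulr_rle0.
apply: Pnon; apply: (same_density_same_state (bounded_mfun_cst rho) _ (has_density_uniform L d)).
split=> //; have [_ Pr2] := Pr.
have rae : ae_eq mu setT (fun x => ((r x - rho) ^+ 2)%:E) (cst 0%E).
  apply/ae_eq_integral_abs => //; first by apply/measurable_EFinP; case: bee.
  transitivity (\int[mu]_x ((r x - rho) ^+ 2)%:E)%E.
    by apply: eq_integral => x _; rewrite gee0_abs// lee_fin sqr_ge0.
  by rewrite bounded_mfun_fineK// -/D D00.
apply: filterS2 Pr2 rae => x h1 h2 _; rewrite h1//.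
by move: (h2 I) => /= -[] /eqP; rewrite sqrf_eq0 subr_eq0 => /eqP.
Unshelve. all: end_near. Qed.

End transition.

(** * The transition temperature *)

(** The factor Theta(k) of the normalised mode cancels. *)
Lemma fourier_coef_ratio {R : realType} (L : {posnum R}) (d : nat) (W : 'rV[R]_d -> R)
  (k : 'I_d -> nat) : trig_approximable L W ->
  fourier_coef L W (fun i => (k i)%:Z) / Theta R (fun i => (k i)%:Z) =
  rho_inf L d `^ 2^-1 * cosine_coef L W k.
Proof.
move=> Wa; have l0 : 0 < L%:num :> R by [].
have Th0 : 0 < Theta R (fun i => (k i)%:Z).
  apply: prodr_gt0 => i _; rewrite sqrtr_gt0.
  by case: (_ == _); rewrite ?subr0// (_ : 2 - 1 = 1 :> R)//; ring.
have kappa : L%:num `^ (- (d%:R / 2)) = rho_inf L d `^ 2^-1 :> R.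
  rewrite /rho_inf -powR_mulrn; last exact: ltW.
  by rewrite -powRN -powRrM mulNr.
have modeE (x : space R d) : mode L (fun i => (k i)%:Z) (vec x) =
    fourier_norm L (fun i => (k i)%:Z) * trig_mode L (fun=> false) k x.
  rewrite /mode; congr (_ * _); apply: eq_bigr => i _; rewrite /mode1 /trig mxE.
  rewrite (_ : _ * angle L _ = 2 * pi * (k i)%:Z%:~R * tnth x i / L%:num); last first.
    by rewrite /angle; ring.
  case: (k i) => [|n]; last by rewrite ltz_nat.
  by rewrite ltxx eqxx mulr0 !mul0r cos0.
have bWT : bounded_mfun (fun x : space R d => W (vec x) * trig_mode L (fun=> false) k x).
  by apply: bounded_mfunM; [exact: (bounded_mfun_vec Wa)|exact: bounded_mfun_trig_mode].
rewrite /fourier_coef.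
rewrite (_ : \int[_]_x _ = fourier_norm L (fun i => (k i)%:Z) * cosine_coef L W k).
  rewrite /fourier_norm kappa; field; exact: lt0r_neq0.
rewrite -RintZ ?torus_lty//; apply: eq_Rintegral => x _.
by rewrite modeE mulrCA.
Qed.

Theorem lemma5p15 (R : realType) (L : {posnum R}) (d : nat) (hd : (0 < d)%N)
  (W : 'rV[R]_d -> R) (W_C2 : class_C 2 W) (W_per : torus_periodic L W)
  (W_even : even_coordinates W) (W_mean : mean_zero L W)
  (m : R) (hm : 1 < m) (beta_c : R)
  (beta_c_cont : continuous_transition_point L m W beta_c) :
  is_beta_sharp L m W beta_c.
Proof.
have Wa : trig_approximable L W.
  by move=> e e0; apply: even_trigonometric_approximation => //; case: W_C2.
have W0 : cosine_coef L W (fun=> 0%N) = 0.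
  rewrite -[RHS]W_mean; apply: eq_Rintegral => x _.
  by rewrite /trig_mode big1 ?mulr1// => i _; rewrite /trig mul0r cos0.
have [[bc0 _ Umin _] _ _] := beta_c_cont.
have rho0 : 0 < rho_inf L d by rewrite /rho_inf invr_gt0 exprn_gt0.
set t0 := m * rho_inf L d `^ (m - 2) / beta_c.
have t00 : 0 < t0 by rewrite divr_gt0// mulr_gt0 ?powR_gt0//; lra.
have stable k : (exists i, k i != 0%N) -> - t0 <= cosine_coef L W k.
  exact: (uniform_minimiser_stable hm Wa W0 bc0 Umin).
have [k0 k0n gk0] : exists2 k0 : 'I_d -> nat, (exists i, k0 i != 0%N) & cosine_coef L W k0 = - t0.
  apply: contrapT => none.
  have gt k : (exists i, k i != 0%N) -> - t0 < cosine_coef L W k.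
    move=> kn; rewrite lt_neqAle stable// andbT; apply/eqP => E.
    by apply: none; exists k.
  have t20 : 0 < t0 / 2 by rewrite divr_gt0.
  have [N HN] := cosine_coef_small_off_box Wa t20.
  (* off the box the coefficients are at least - t0 / 2, so a maximum over the box
     gives a gap *)
  pose v := \big[Num.max/(t0 / 2)]_(k : {ffun 'I_d -> 'I_N} | [exists i, k i != 0%N :> nat])
     (- cosine_coef L W (fun i => k i)).
  have vt0 : v < t0.
    apply: bigmax_lt; first by lra.
    by move=> k /existsP kn; rewrite ltrNl; exact: gt.
  have v0 : t0 / 2 <= v by exact: bigmax_ge_id.
  apply: (continuous_no_gap hm Wa W0 hd beta_c_cont _ vt0); first by lra.
  move=> k kn.
  have [box|] := pselect (forall i, (k i < N)%N); last first.
    move=> /existsNP[i /negP]; rewrite -leqNgt => Nk.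
    have := HN k (ex_intro _ i Nk); rewrite ler_norml => /andP[h _]; lra.
  pose k' : {ffun 'I_d -> 'I_N} := [ffun i => Ordinal (box i)].
  have kk' : k = (fun i => k' i) by apply/funext => i; rewrite ffunE.
  rewrite kk' lerNl; apply: le_bigmax_cond; apply/existsP.
  by case: kn => i ki; exists i; rewrite ffunE.
have kap0 : 0 < rho_inf L d `^ 2^-1 by exact: powR_gt0.
exists (rho_inf L d `^ 2^-1 * - t0).
  split; first by exists k0; split => //; rewrite fourier_coef_ratio// gk0.
  move=> _ [k [kn ->]]; rewrite fourier_coef_ratio// ler_pM2l//; exact: stable.
have -> : rho_inf L d `^ (m - 3 / 2) = rho_inf L d `^ (m - 2) * rho_inf L d `^ 2^-1.
  rewrite -powRD; last by apply/implyP => _; rewrite gt_eqF.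
  by congr (_ `^ _); field.
have p0 : 0 < rho_inf L d `^ (m - 2) by exact: powR_gt0.
rewrite /t0; move: kap0 p0; move: (_ `^ 2^-1) (_ `^ (m - 2)) => a b a0 b0.
by field; rewrite !gt_eqF//; lra.
Qed.
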